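(* Let $\bar\ell:\mathbb{R}^d\to\mathbb{R}$ be twice differentiable and $\delta$-strongly convex for some $\delta>0$, i.e. $\nabla^2\bar\ell(\theta)\succcurlyeq\delta I$ for all $\theta\in\mathbb{R}^d$, and let $p(\theta\mid\mathcal{D})\propto e^{-\bar\ell(\theta)}$ be the corresponding posterior density. For $\tau=(m,C)\in\Omega$ let $q_\tau=\mathcal{N}(m,CC^\top)$, and let $\tau_*=(m_*,C_* )\in\Omega$ be the minimizer of $\tau\mapsto\mathrm{KL}[q_\tau\,\|\,p(\cdot\mid\mathcal{D})]$ over $\Omega$. Assume bounded iterates: there are constants $0<\xi_l\le\xi_u<\infty$ and $\lambda_{\min}>0$ such that the iterates $C_t$ of the square-root variational Newton algorithm (defined in the context) satisfy $\xi_l\le\|C_t\|_F\le\xi_u$ and $V_t=C_tC_t^\top\succcurlyeq\lambda_{\min}I$ for all $t\ge0$. Put $\lambda^g_{\min}=\min\{\lambda_{\min},\lambda_{\min}^2/2\}$. Then the KL functional satisfies a local Polyak–Łojasiewicz (PL) inequality with PL constant $\mu=\delta\lambda^g_{\min}$, that is, for $\tau=(m,C)\in\Omega$, $$\Big\|\nabla_\tau\mathrm{KL}\big[q_\tau\,\|\,p(\cdot\mid\mathcal{D})\big]\Big\|_{F_\tau^{-1}}^2\ \ge\ 2\mu\Big(\mathrm{KL}\big[q_\tau\,\|\,p(\cdot\mid\mathcal{D})\big]-\mathrm{KL}\big[q_{\tau_*}\,\|\,p(\cdot\mid\mathcal{D})\big]\Big).$$ Here ''local'' means that the inequality is asserted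 for the chosen parametrization $\tau=(m,C)$ only, not for all parametrizations.
   Context: $\Omega$ is the set of pairs $(m,C)$ with $m\in\mathbb{R}^d$ and $C\in\mathbb{R}^{d\times d}$ lower triangular with positive diagonal entries (so $V=CC^\top\succ0$); coordinates on $\Omega$ are the entries of $m$ and the entries of $C$ on and below the diagonal, and $\nabla_\tau$ is the gradient in these coordinates. $F_\tau=\mathbb{E}_{\theta\sim q_\tau}[\nabla_\tau\log q_\tau(\theta)\,(\nabla_\tau\log q_\tau(\theta))^\top]$ is the Fisher information matrix (positive definite), and $\|v\|_{F_\tau^{-1}}^2=v^\top F_\tau^{-1}v$. The square-root variational Newton algorithm, with step size $\rho>0$ and started at $(m_0,C_0)$ with $m_0\in\mathbb{R}^d$ and $C_0$ a positive multiple of the identity, is $$C_{t+1}=C_t-\rho\,C_t\,\mathrm{tril}\big[C_t^\top H_tC_t-I\big],\qquad m_{t+1}=m_t-\rho\,C_tC_t^\top g_t,$$ where $g_t=\mathbb{E}_{\theta\sim\mathcal{N}(m_t,C_tC_t^\top)}[\nabla\bar\ell(\theta)]$ and $H_t=\mathbb{E}_{\theta\sim\mathcal{N}(m_t,C_tC_t^\top)}[\nabla^2\bar\ell(\theta)]$. For a square matrix $A$, $\mathrm{tril}[A]$ is the lower-triangular matrix with entries $A_{ij}$ for $i>j$, $\tfrac12A_{ii}$ for $i=j$, and $0$ for $i<j$. $\|\cdot\|_F$ is the Frobenius norm, $\succcurlyeq$ the Loewner order, and $\mathrm{KL}[q\|p]=\int q\log(q/p)$. The function $\bar\ell$ is the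 negative log-likelihood plus the negative log-prior, so that $p(\theta\mid\mathcal{D})=e^{-\bar\ell(\theta)}/Z$ with $Z=\int e^{-\bar\ell}$. All expectations appearing are assumed finite.
   Formalization: The inequality is asserted for τ=(m,C) in Ω with CCᵀ ≽ λ_min I rather than for all of Ω (where it fails as C→0), and the iterates (m_t,C_t) are assumed to stay in Ω (without this a large step size ρ gives a counterexample). *)

(* Defs.v *)
From HB Require Import structures.
From mathcomp Require Import all_boot all_order all_algebra.
From mathcomp Require Import all_classical all_reals all_analysis.
Set Implicit Arguments.
Unset Strict Implicit.
Unset Printing Implicit Defensive.

Import Order.TTheory GRing.Theory Num.Theory numFieldNormedType.Exports.

Local Open Scope classical_set_scope.
Local Open Scope ring_scope.

Section lebesgue_tuple.
Context (R : realType).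
Local Notation RT := (measurableTypeR R).

(* Lebesgue measure on R^n, carried by n-tuples because matrices have no
   measurable structure in the library: the iterated product of the
   one-dimensional Lebesgue measure, transported along
   R * R^n ~ R^(n+1); on R^0 it is the unit mass at the only point. *)
Fixpoint lebesgue_tuple (n : nat) : set (n.-tuple RT) -> \bar R :=
  if n is n'.+1 then
    pushforward (lebesgue_measure \x @lebesgue_tuple n')%E
      (fun p : RT * n'.-tuple RT => [tuple of p.1 :: p.2])
  else \d_ ([tuple] : 0.-tuple RT).

Let measurable_cons_pair n : measurable_fun [set: RT * n.-tuple RT]
  (fun p => [tuple of p.1 :: p.2]).
Proof. exact: measurable_cons. Qed.

Let lebesgue_tuple_sfm n : {mu : {sigma_finite_measure set (n.-tuple RT) -> \bar R} |
  @lebesgue_tuple n = mu :> (set _ -> \bar R)}.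
Proof.
elim: n => [|n [mu lE]]; first 
  by eexists (\d_ ([tuple] : 0.-tuple RT)
    : {sigma_finite_measure set _ -> \bar R}).
pose c := fun p : RT * n.-tuple RT => [tuple of p.1 :: p.2].
pose nu : {measure set _ -> \bar R} :=
  measure_function_pushforward__canonical__measure_function_Measure
    (lebesgue_measure \x mu)%E (@measurable_cons_pair n).
have sf : sigma_finite setT nu.
  have /sigma_finiteP[F [FT ndF Foo]] := sigma_finiteT (@lebesgue_measure R).
  have /sigma_finiteP[G [GT ndG Goo]] := sigma_finiteT mu.
  pose FG k := F k `*` G k.
  have FGT : setT = \bigcup_k FG k.
    rewrite -setXTT FT GT predeqE => -[x y]; split.
      move=> [/= [i _ Fix] [k _ Gky]]; exists (maxn i k) => //; split.
      - by move: x Fix; exact/subsetPset/ndF/leq_maxl.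
      - by move: y Gky; exact/subsetPset/ndG/leq_maxr.
    by move=> [i _ []/= ? ?]; split; exists i.
  have FGoo k : measurable (FG k) /\ ((lebesgue_measure \x mu) (FG k) < +oo)%E.
    have [? ?] := Foo k; have [? ?] := Goo k.
    split; first exact: measurableX.
    by rewrite product_measure1E// lte_mul_pinfty// ge0_fin_numE.
  exists (fun k => (fun t : n.+1.-tuple RT =>
      (thead t, [tuple of behead t])) @^-1` FG k).
    rewrite -preimage_bigcup -FGT preimage_setT //.
  move=> k; have [mF Fk] := FGoo k; split.
    rewrite -[X in measurable X]setTI.
    apply: (measurable_fun_pair _ _) => //.
      exact: measurable_tnth.
    exact: measurable_behead.
  rewrite /nu/= /pushforward; apply: le_lt_trans Fk.
  rewrite le_measure ?inE//.
    rewrite -[X in measurable X]setTI; apply: measurable_cons_pair => //.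
    rewrite -[X in measurable X]setTI.
    apply: (measurable_fun_pair _ _) => //.
      exact: measurable_tnth.
    exact: measurable_behead.
  move=> [x t] /=; rewrite /c /= theadE.
  by have -> : [tuple of behead (x :: t)] = t by apply: val_inj.
pose S := Measure_isSigmaFinite.Build _ _ _ _ sf.
pose nu' : {sigma_finite_measure set _ -> \bar R} :=
  HB.pack (nu : set _ -> \bar R) (Measure.on nu) S.
exists nu'; by rewrite /= lE.
Qed.

Variable n : nat.

Let leb0 : @lebesgue_tuple n set0 = 0%E.
Proof. by have [mu ->] := lebesgue_tuple_sfm n; exact: measure0. Qed.

Let leb_ge0 A : (0 <= @lebesgue_tuple n A)%E.
Proof. by have [mu ->] := lebesgue_tuple_sfm n; exact: measure_ge0. Qed.

Let leb_sigma_additive : semi_sigma_additive (@lebesgue_tuple n).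
Proof.
by have [mu ->] := lebesgue_tuple_sfm n; exact: measure_semi_sigma_additive.
Qed.

HB.instance Definition _ := isMeasure.Build _ _ _ (@lebesgue_tuple n)
  leb0 leb_ge0 leb_sigma_additive.

Let leb_sigma_finite : sigma_finite setT (@lebesgue_tuple n).
Proof. by have [mu ->] := lebesgue_tuple_sfm n; exact: sigma_finiteT. Qed.

HB.instance Definition _ := Measure_isSigmaFinite.Build _ _ _
  (@lebesgue_tuple n) leb_sigma_finite.

End lebesgue_tuple.

Section integration_on_Rn.
Context (R : realType) (n : nat).
Implicit Types f : 'cV[R]_n -> R.

Definition vec_of_tuple (t : n.-tuple (measurableTypeR R)) : 'cV[R]_n :=
  \col_i tnth t i.

(* Meaningful when f is integrable: the value is 0 when the integral is
   infinite. *)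
Definition integral_Rn f : R :=
  \int[@lebesgue_tuple R n]_t f (vec_of_tuple t).

Definition integrable_Rn f : Prop :=
  (@lebesgue_tuple R n).-integrable setT (fun t => (f (vec_of_tuple t))%:E).

End integration_on_Rn.

Section calculus.
Context (R : realType) (d : nat).
Implicit Types f : 'cV[R]_d -> R.

Definition gradient f (x : 'cV[R]_d) : 'cV[R]_d :=
  \col_i 'D_(delta_mx i ord0) f x.

Definition hessian f (x : 'cV[R]_d) : 'M[R]_d :=
  \matrix_(i, j) 'D_(delta_mx j ord0) (fun y => gradient f y i ord0) x.

Definition twice_differentiable f : Prop :=
  (forall x, differentiable f x) /\ (forall x, differentiable (gradient f) x).

End calculus.

Section matrices.
Context (R : realType) (d : nat).
Implicit Types A B : 'M[R]_d.

(* The Loewner order A <= B, through quadratic forms. It is meant for symmetric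
   A and B: the matrices compared below are scalar matrices, Gram matrices
   C C^T, and Hessians, symmetric as soon as f is twice differentiable. *)
Definition loewner_le A B : Prop :=
  forall v : 'cV[R]_d, 0 <= (v^T *m (B - A) *m v) ord0 ord0.

Definition frobenius_norm A : R := Num.sqrt (\sum_i \sum_j A i j ^+ 2).

Definition tril A : 'M[R]_d :=
  \matrix_(i, j) if (j < i)%N then A i j
                 else if i == j then A i j / 2 else 0.

End matrices.

Section gaussian_family.
Context (R : realType) (d : nat).

(* tau = (m, C) *)
Definition param : Type := ('cV[R]_d * 'M[R]_d)%type.
Implicit Types (tau : param) (f p : 'cV[R]_d -> R).

Definition Omega tau : Prop :=
  is_trig_mx tau.2 /\ forall i, 0 < tau.2 i i.

Definition cov tau : 'M[R]_d := tau.2 *m tau.2^T.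

Definition gaussian_pdf (m : 'cV[R]_d) (V : 'M[R]_d) (x : 'cV[R]_d) : R :=
  expR (- ((x - m)^T *m invmx V *m (x - m)) ord0 ord0 / 2) /
  Num.sqrt ((2 * pi) ^+ d * \det V).

Definition q_pdf tau : 'cV[R]_d -> R := gaussian_pdf tau.1 (cov tau).

Definition q_expect tau f : R := integral_Rn (fun x => f x * q_pdf tau x).

Definition q_integrable tau f : Prop :=
  integrable_Rn (fun x => f x * q_pdf tau x).

(* Coordinates on Omega: the entries of m, and the entries (i, j) of C with
   j <= i. Vectors and matrices indexed by coordinates are indexed by the
   ordinals below #|coord|, through the enumeration of coord. *)
Definition coord : finType :=
  ('I_d + {ij : 'I_d * 'I_d | (ij.2 <= ij.1)%N})%type.

Definition coord_dir (c : coord) : param :=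
  match c with
  | inl i => (delta_mx i ord0, 0)
  | inr ij => (0, delta_mx (val ij).1 (val ij).2)
  end.

Definition grad_tau (F : param -> R) tau : 'cV[R]_#|coord| :=
  \col_k 'D_(coord_dir (enum_val k)) F tau.

Definition score tau (x : 'cV[R]_d) : 'cV[R]_#|coord| :=
  grad_tau (fun tau' => ln (q_pdf tau' x)) tau.

Definition fisher tau : 'M[R]_#|coord| :=
  \matrix_(a, b) q_expect tau (fun x => (score tau x *m (score tau x)^T) a b).

Definition fisher_dual_normsq tau (v : 'cV[R]_#|coord|) : R :=
  (v^T *m invmx (fisher tau) *m v) ord0 ord0.

Definition KL_integrand tau p (x : 'cV[R]_d) : R :=
  q_pdf tau x * ln (q_pdf tau x / p x).

Definition KL p tau : R := integral_Rn (KL_integrand tau p).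

Definition posterior (l : 'cV[R]_d -> R) (x : 'cV[R]_d) : R :=
  expR (- l x) / integral_Rn (fun y => expR (- l y)).

Definition is_KL_minimizer p tau : Prop :=
  Omega tau /\ forall tau', Omega tau' -> KL p tau <= KL p tau'.

Definition expected_gradient (l : 'cV[R]_d -> R) tau : 'cV[R]_d :=
  \col_i q_expect tau (fun x => gradient l x i ord0).

Definition expected_hessian (l : 'cV[R]_d -> R) tau : 'M[R]_d :=
  \matrix_(i, j) q_expect tau (fun x => hessian l x i j).

Definition svn_step (l : 'cV[R]_d -> R) (rho : R) tau : param :=
  let m := tau.1 in let C := tau.2 in
  (m - rho *: (C *m C^T *m expected_gradient l tau),
   C - rho *: (C *m tril (C^T *m expected_hessian l tau *m C - 1%:M))).

(* the initial mean m_0 is arbitrary *)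
Definition svn_iterates (l : 'cV[R]_d -> R) (rho : R) (tau : nat -> param)
    : Prop :=
  (exists c, 0 < c /\ (tau 0).2 = c%:M) /\
  forall t, tau t.+1 = svn_step l rho (tau t).

End gaussian_family.

(* Main.v *)
(** Substituting theta = m + C z with z standard Gaussian, the divergence is
    E l(m + C z) - sum_i ln C_ii up to a constant.  Strong convexity of l bounds
    KL(tau_star) - KL(tau) from below by the gradient term, plus
    delta lambda_min / 2 times the squared displacement measured in the
    coordinates (C^-1 u, C^-1 B) of a tangent vector (u, B), plus the convexity
    gaps a - ln (1 + a) of the logarithms.  In these coordinates the scores are
    the Hermite polynomials z_i, z_i z_j and z_i^2 - 1, so the Fisher matrix is
    diagonal with weights 1, 1 and 2, and the inequality splits into one scalar
    inequality per coordinate.  The weight 2 would cost a factor 2, too much as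
    soon as lambda_min > 1; it is paid for by the curvature of -ln C_ii,
    provided that delta lambda_min <= 1.  The latter follows from the iterates:
    otherwise the first diagonal entry of C_t would decrease by at least a fixed
    amount at every step.  The inequality thus holds even with the constant
    delta lambda_min. *)
Require Import Defs.
From HB Require Import structures.
From mathcomp Require Import all_boot all_order all_algebra.
From mathcomp Require Import all_classical all_reals all_analysis.
From mathcomp Require Import measurable_realfun ring lra.
Set Implicit Arguments.
Unset Strict Implicit.
Unset Printing Implicit Defensive.
Import Order.TTheory GRing.Theory Num.Theory numFieldNormedType.Exports.
Local Open Scope classical_set_scope.
Local Open Scope ring_scope.

(** * Lebesgue measure on tuples *)

(** Write [kappa = delta * lambda_min], [T] for a component of the transformed gradient of the
    expected [l], and [A] for the matching displacement. A coordinate of weight 1 contributes the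
    perfect square [(T + kappa * A) ^+ 2]. On the diagonal, with [S = T - 1], the minimum over all
    [S] is [2 * kappa * (A - ln (1 + A)) - kappa ^+ 2 * A ^+ 2], which is negative for large [A],
    because the convexity gap of the logarithm grows only linearly. Curvature therefore pays for
    small displacements only; for large ones the one-sided bound [T >= kappa] is needed, which is
    strong convexity in the direction of one column of [C]. Integrability is obtained in stages:
    finiteness of the divergence on all of [Omega] gives that of [l] under every Gaussian of the
    family, and convexity then dominates the difference quotients of [l], hence controls its
    gradient. The triangular shape serves twice: changes of variables reduce to dimension one, and
    multiplication by [C^-1] preserves the coordinates of [Omega]. *)

Section lebesgue_affine.
Context {R : realType}.
Local Notation RT := (measurableTypeR R).
Local Notation mu := (@lebesgue_measure R).

Lemma measurable_affine (a c : R) : measurable_fun [set: RT] (fun x : RT => a + c * x : RT).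
Proof.
by apply: measurable_funD => //; apply: measurable_funM. 
Qed.

(** Both sides are measures in [A], so by uniqueness it suffices to compare them on half-open
    intervals, whose preimages are explicit; a negative slope exchanges the open and the closed
    end. *)
Lemma lebesgue_measure_affine (a c : R) (A : set RT) : c != 0 -> measurable A ->
  mu A = (`|c|%:E * mu ((fun x => (a + c * x)%R) @^-1` A))%E.
Proof.
move=> c0 mA.
have mf := measurable_affine a c.
pose k : {nonneg R} := NngNum (normr_ge0 c).
pose nu : {measure set RT -> \bar R} := mscale k
  (measure_function_pushforward__canonical__measure_function_Measure mu mf).
suff H : forall X, ocitv X -> mu X = nu X by rewrite (lebesgue_measure_unique H).
move=> _ [[x y]] _ <- /=.
change (mu [set` `]x, y]] =
  `|c|%:E * mu ((fun z : R => (a + c * z)%R) @^-1` [set` `]x, y]]))%E.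
have [cp|cn] := ltP 0 c.
- rewrite [X in (_ * mu X)%E](_ : _ = [set` `](x - a) / c, (y - a) / c]]); last first.
    apply/seteqP; split => z /=; rewrite !in_itv/= ltr_pdivrMr // ler_pdivlMr //;
    rewrite ltrBlDl lerBrDl (mulrC z) //.
  rewrite !lebesgue_measure_itv/= !lte_fin ltr_pM2r ?invr_gt0 // ltrD2r.
  case: ifP => _; rewrite ?mule0 // -!EFinB -EFinM gtr0_norm//; congr EFin; by field.
- have cn' : c < 0 by rewrite lt_neqAle c0.
  rewrite [X in (_ * mu X)%E](_ : _ = [set` `[(y - a) / c, (x - a) / c[]); last first.
    apply/seteqP; split => z /=; rewrite !in_itv/= ltr_ndivlMr // ler_ndivrMr //;
    rewrite ltrBlDl lerBrDl (mulrC z) andbC//.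
  rewrite !lebesgue_measure_itv/= !lte_fin ltr_nM2r ?invr_lt0 // ltrD2r.
  case: ifP => _; rewrite ?mule0 // -!EFinB -EFinM ltr0_norm//; congr EFin; by field.
Qed.

Lemma ge0_integral_affine (a c : R) (f : RT -> \bar R) : c != 0 ->
  measurable_fun [set: RT] f -> (forall x, 0 <= f x)%E ->
  (\int[mu]_x f x = `|c|%:E * \int[mu]_x f (a + c * x)%R)%E.
Proof.
move=> c0 mf f0.
have mg := measurable_affine a c.
pose k : {nonneg R} := NngNum (normr_ge0 c).
pose nu : {measure set RT -> \bar R} := mscale k
  (measure_function_pushforward__canonical__measure_function_Measure mu mg).
transitivity (\int[nu]_x f x)%E.
  apply: eq_measure_integral => A mA _.
  exact: (lebesgue_measure_affine a c0).
rewrite ge0_integral_mscale//; congr (_ * _)%E.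
by rewrite (ge0_integral_pushforward mg).
Qed.

End lebesgue_affine.

Section lebesgue_tuple_theory.
Context {R : realType}.
Local Notation RT := (measurableTypeR R).
Local Notation mu := (@lebesgue_measure R).
Local Notation leb n := (@lebesgue_tuple R n).

Lemma ge0_integral_lebesgue_tuple0 (f : 0.-tuple RT -> \bar R) :
  measurable_fun setT f ->
  (\int[leb 0]_t f t = f [tuple])%E.
Proof. by move=> mf; rewrite integral_dirac// diracT mul1e. Qed.

Let cons n (p : RT * n.-tuple RT) : n.+1.-tuple RT := [tuple of p.1 :: p.2].

Let mcons n : measurable_fun setT (@cons n).
Proof. exact: measurable_cons. Qed.

Lemma ge0_integral_lebesgue_tupleS n (f : n.+1.-tuple RT -> \bar R) :
  measurable_fun setT f -> (forall t, 0 <= f t)%E ->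
  (\int[leb n.+1]_t f t = \int[mu]_x \int[leb n]_t f [tuple of x :: t])%E.
Proof.
move=> mf f0.
transitivity (\int[pushforward (mu \x leb n)%E (@cons n)]_t f t)%E; first by [].
rewrite (ge0_integral_pushforward (@mcons n)) //= preimage_setT.
rewrite fubini_tonelli1 //; exact: (measurableT_comp mf (@mcons n)).
Qed.

End lebesgue_tuple_theory.

Section tuple_affine.
Context {R : realType}.
Local Notation RT := (measurableTypeR R).
Local Notation mu := (@lebesgue_measure R).
Local Notation leb n := (@lebesgue_tuple R n).

(** The coefficients are functions, so that an induction on [n] can drop the first row and column by
    composing with [lift ord0]. *)
Definition tuple_affine n (a : 'I_n -> R) (C : 'I_n -> 'I_n -> R)
    (t : n.-tuple RT) : n.-tuple RT :=
  [tuple a i + \sum_j C i j * tnth t j | i < n].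

Lemma measurable_tuple_affine n a C : measurable_fun setT (@tuple_affine n a C).
Proof.
apply/measurable_fun_tnthP => i.
rewrite (_ : _ \o _ = fun t : n.-tuple RT => a i + \sum_j C i j * tnth t j); last first.
  by apply/funext => t /=; rewrite tnth_mktuple.
apply: measurable_funD => //; apply: measurable_sum => j.
by apply: measurable_funM => //; exact: measurable_tnth.
Qed.

Lemma tuple_affine_cons n (a : 'I_n.+1 -> R) C x (t : n.-tuple RT) :
  (forall i j : 'I_n.+1, (i < j)%N -> C i j = 0) ->
  tuple_affine a C [tuple of x :: t] =
  [tuple of (a ord0 + C ord0 ord0 * x) ::
    tuple_affine (fun i => a (lift ord0 i) + C (lift ord0 i) ord0 * x)
      (fun i j => C (lift ord0 i) (lift ord0 j)) t].
Proof.
move=> Clow; apply: eq_from_tnth => i; rewrite tnth_mktuple.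
have [->|i0] := eqVneq i ord0.
  rewrite tnth0 big_ord_recl tnth0 big1 ?addr0// => j _.
  by rewrite Clow// mul0r.
have [k ->] : exists k, i = lift ord0 k.
  by case: (unliftP ord0 i) i0 => [k ->|->]; [exists k | rewrite eqxx].
rewrite tnthS tnth_mktuple big_ord_recl tnth0 addrA; congr (_ + _).
by apply: eq_bigr => j _; rewrite tnthS.
Qed.

(** Triangularity reduces the determinant formula to one-dimensional substitutions. Tonelli isolates
    the first variable, which is substituted first; for each of its values the remaining variables
    undergo a smaller triangular map whose translation depends on that value. *)
Lemma ge0_integral_tuple_affine n (a : 'I_n -> R) C (f : n.-tuple RT -> \bar R) :
  (forall i j : 'I_n, (i < j)%N -> C i j = 0) -> (forall i, C i i != 0) ->
  measurable_fun [set: n.-tuple RT] f -> (forall t, 0 <= f t)%E ->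
  (\int[leb n]_t f t =
   `|\prod_i C i i|%:E * \int[leb n]_t f (tuple_affine a C t))%E.
Proof.
elim: n a C f => [|n IH] a C f Clow C0 mf f0.
  rewrite !ge0_integral_lebesgue_tuple0 ?big_ord0 ?normr1 ?mul1e; first last.
  - exact: mf.
  - by apply: (measurableT_comp mf); exact: measurable_tuple_affine.
  by congr f; apply: val_inj; rewrite /= enum_ord0.
have mfc : measurable_fun [set: RT * n.-tuple RT] (fun p => f [tuple of p.1 :: p.2]).
  by apply: (measurableT_comp mf); exact: measurable_cons.
have mK : measurable_fun [set: RT] (fun x => \int[leb n]_t f [tuple of x :: t])%E.
  exact: (measurable_fun_fubini_tonelli_F _ mfc (fun=> f0 _)).
rewrite ge0_integral_lebesgue_tupleS//.
rewrite (ge0_integral_affine (a ord0) (C0 ord0))//; last by move=> x; apply: integral_ge0.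
rewrite ge0_integral_lebesgue_tupleS//; last first.
  by apply: (measurableT_comp mf); exact: measurable_tuple_affine.
rewrite big_ord_recl normrM EFinM -muleA; congr (_ * _)%E.
have mfa : measurable_fun [set: n.+1.-tuple RT] (f \o tuple_affine a C).
  by apply: (measurableT_comp mf); exact: measurable_tuple_affine.
have mfac : measurable_fun [set: RT * n.-tuple RT]
    (fun p => (f \o tuple_affine a C) [tuple of p.1 :: p.2]).
  by apply: (measurableT_comp mfa); exact: measurable_cons.
have mKa : measurable_fun [set: RT]
    (fun x => \int[leb n]_t f (tuple_affine a C [tuple of x :: t]))%E.
  exact: (measurable_fun_fubini_tonelli_F _ mfac (fun=> f0 _)).
rewrite -ge0_integralZl ?lee_fin//; last by move=> x _; apply: integral_ge0.
apply: eq_integral => x _.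
under [in RHS]eq_integral do rewrite (tuple_affine_cons _ _ _ Clow).
rewrite (IH (fun i => a (lift ord0 i) + C (lift ord0 i) ord0 * x)
            (fun i j => C (lift ord0 i) (lift ord0 j)))//.
- by move=> i j ij; rewrite Clow.
- by apply: (measurableT_comp mf); apply: measurable_cons => //; exact: measurable_cst.
Qed.

(** Integrability and value are proved together, since Fubini in the inductive step needs the
    integrability of the shorter product. *)
Lemma integral_prod_tuple n (f : 'I_n -> RT -> R) :
  (forall i, mu.-integrable setT (EFin \o f i)) ->
  (leb n).-integrable setT (fun t => (\prod_i f i (tnth t i))%:E) /\
  (\int[leb n]_t (\prod_i f i (tnth t i))%:E =
   (\prod_i (\int[mu]_x f i x)%R)%:E)%E.
Proof.
elim: n f => [|n IH] f intf.
  have m0 : measurable_fun [set: 0.-tuple RT]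
      (fun t : 0.-tuple RT => (\prod_i f i (tnth t i))%:E).
    under eq_fun do rewrite big_ord0. exact: measurable_cst.
  split; last by rewrite ge0_integral_lebesgue_tuple0// !big_ord0.
  apply/integrableP; split => //.
  rewrite ge0_integral_lebesgue_tuple0; first by rewrite big_ord0 ltry.
  exact: measurableT_comp.
set g := fun t : n.-tuple RT => \prod_i f (lift ord0 i) (tnth t i).
have [ig Eg] := IH (fun i => f (lift ord0 i)) (fun i => intf _).
have mf i : measurable_fun [set: RT] (f i).
  by apply/measurable_EFinP; exact: measurable_int (intf i).
have mg : measurable_fun [set: n.-tuple RT] g.
  by apply/measurable_EFinP; exact: measurable_int ig.
have mh : measurable_fun [set: n.+1.-tuple RT]
    (fun t : n.+1.-tuple RT => (\prod_i f i (tnth t i))%:E).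
  apply/measurable_EFinP; apply: measurable_prod => i _.
  by apply: (measurableT_comp (mf i)); exact: measurable_tnth.
have E x (t : n.-tuple RT) : (\prod_i f i (tnth [tuple of x :: t] i)) = f ord0 x * g t.
  by rewrite big_ord_recl tnth0; congr (_ * _); apply: eq_bigr => i _; rewrite tnthS.
have mhc : measurable_fun [set: RT * n.-tuple RT] (fun p => (f ord0 p.1 * g p.2)%:E).
  apply/measurable_EFinP; apply: measurable_funM.
    by apply: (measurableT_comp (mf ord0)).
  by apply: (measurableT_comp mg).
have ihc : (mu \x leb n)%E.-integrable setT (fun p : RT * n.-tuple RT => (f ord0 p.1 * g p.2)%:E).
  apply/integrable12ltyP => //=.
  have [_ fy] := integrableP _ _ _ (intf ord0).
  have [_ gy] := integrableP _ _ _ ig.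
  have -> : (\int[mu]_x \int[leb n]_y `|(f ord0 x * g y)%:E| =
      (\int[mu]_x `|(f ord0 x)%:E|) * (\int[leb n]_y `|(g y)%:E|))%E.
    rewrite -ge0_integralZr//; last 2 first.
    - by apply: measurableT_comp => //; apply/measurable_EFinP.
    - exact: integral_ge0.
    apply: eq_integral => x _.
    rewrite -ge0_integralZl//; last by apply: measurableT_comp => //; apply/measurable_EFinP.
    by apply: eq_integral => y _; rewrite EFinM abseM.
  apply: lte_mul_pinfty => //; first exact: integral_ge0.
  by rewrite ge0_fin_numE//; exact: integral_ge0.
split.
  apply/integrableP; split => //.
  rewrite ge0_integral_lebesgue_tupleS//; last exact: measurableT_comp.
  under eq_integral do under eq_integral do rewrite E.
  by have /integrable12ltyP := ihc; apply.
pose c (p : RT * n.-tuple RT) : n.+1.-tuple RT := [tuple of p.1 :: p.2].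
have mc : measurable_fun setT c by exact: measurable_cons.
have Ec : (fun t : n.+1.-tuple RT => (\prod_i f i (tnth t i))%:E) \o c =
    (fun p : RT * n.-tuple RT => (f ord0 p.1 * g p.2)%:E).
  by apply/funext => p /=; rewrite /c E.
have ihc' : (mu \x leb n)%E.-integrable (c @^-1` setT)
    ((fun t : n.+1.-tuple RT => (\prod_i f i (tnth t i))%:E) \o c).
  by rewrite preimage_setT Ec.
transitivity (\int[mu \x leb n]_p (f ord0 p.1 * g p.2)%:E)%E.
  have := integral_pushforward mc mh ihc' measurableT.
  by rewrite preimage_setT Ec.
rewrite -integral12_prod_meas1// /fubini_F /=.
rewrite big_ord_recl EFinM.
rewrite -Eg.
transitivity (\int[mu]_x ((f ord0 x)%:E * \int[leb n]_y (g y)%:E))%E.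
  apply: eq_integral => x _; rewrite -integralZl//.
have gfin : (\int[leb n]_y (g y)%:E)%E \is a fin_num by apply: integrable_fin_num.
have ffin : (\int[mu]_x (f ord0 x)%:E)%E \is a fin_num.
  by apply: integrable_fin_num => //; exact: (intf ord0).
rewrite -(fineK gfin) integralZr//; last exact: (intf ord0).
by rewrite /Rintegral (fineK ffin).
Qed.

End tuple_affine.

(** * Standard Gaussian expectations *)

Section gaussian_1d.
Context {R : realType}.
Local Notation RT := (measurableTypeR R).
Local Notation mu := (@lebesgue_measure R).

Definition gauss1 (x : R) : R := normal_pdf 0 1 x.

Lemma gauss1E x : gauss1 x = normal_peak 1 * expR (- (x ^+ 2) / 2).
Proof. by rewrite /gauss1 normal_pdfE ?oner_eq0// /normal_fun subr0 expr1n. Qed.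

Lemma gauss1_gt0 x : 0 < gauss1 x.
Proof. by rewrite gauss1E mulr_gt0 ?expR_gt0// normal_peak_gt0// oner_neq0. Qed.

Lemma measurable_gauss1 : measurable_fun [set: RT] gauss1.
Proof. exact: measurable_normal_pdf. Qed.

Lemma is_derive_gauss1 (x : R) : is_derive x 1 gauss1 (- x * gauss1 x).
Proof.
rewrite (_ : gauss1 = fun y => normal_peak 1 * expR (- (y ^+ 2) / 2)); last first.
  by apply/funext => y; exact: gauss1E.
apply: is_derive_eq.
rewrite /GRing.scale /=; set e := expR _; lra.
Qed.

(** Passing to standard deviation 2 frees a factor [expR u] with [u = 3 * x ^+ 2 / 8], which absorbs
    the quartic. The bound [1 + u ^+ 2 / 2 <= expR u] yields the coefficient 9/128 of [x ^+ 4], and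
    15 is the least integer whose product with it is at least 1. Degree 4 is what products of two
    Hermite polynomials of degree at most 2 require. *)
Let tail_pdf : exists2 K : R, 0 <= K &
  forall x : R, (1 + x ^+ 4) * gauss1 x <= K * normal_pdf 0 2 x.
Proof.
have p2 : 0 < normal_peak (2 : R) by rewrite normal_peak_gt0.
have p1 : 0 < normal_peak (1 : R) by rewrite normal_peak_gt0.
exists (15 * normal_peak 1 / normal_peak 2).
  by rewrite divr_ge0 ?mulr_ge0 ?ltW.
move=> x; rewrite gauss1E normal_pdfE// /normal_fun subr0.
rewrite [leRHS](_ : _ = 15 * normal_peak 1 * expR (- x ^+ 2 / (2 ^+ 2 *+ 2))); last first.
  by rewrite mulrA divfK// gt_eqF.
rewrite (_ : - x ^+ 2 / (2 ^+ 2 *+ 2) = 3 * x ^+ 2 / 8 + - (x ^+ 2) / 2); last by rewrite -mulr_natr; field.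
rewrite expRD.
have u0 : 0 <= 3 * x ^+ 2 / 8 by have := sqr_ge0 x; lra.
have := expR_ge1Dxn 1 u0.
set e := expR (3 * _ / _); set e' := expR _ => h.
have e'0 : 0 < e' by exact: expR_gt0.
rewrite [leRHS](_ : _ = (15 * e) * (normal_peak 1 * e')); last by ring.
rewrite ler_wpM2r ?mulr_ge0 ?ltW//.
have x4 : 0 <= x ^+ 4 by rewrite exprn_even_ge0.
move: h; rewrite !factS fact0.
rewrite (_ : (3 * x ^+ 2 / 8) ^+ 2 = 9 * x ^+ 4 / 64); last by field.
rewrite (_ : (2 * (1 * 1))%N = 2%N)//; lra.
Qed.

Lemma integrable_gauss1_poly (h : R -> R) (c : R) :
  measurable_fun [set: RT] h -> (forall x, `|h x| <= c * (1 + x ^+ 4)) ->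
  mu.-integrable setT (EFin \o (fun x => h x * gauss1 x)).
Proof.
move=> mh hb; have [K K0 tail] := tail_pdf.
have c0 : 0 <= c.
  by have := hb 0; rewrite expr0n/= addr0 mulr1; apply: le_trans.
apply: (@le_integrable _ _ _ mu _ measurableT _
    (fun x : RT => ((c * K)%:E * (normal_pdf 0 2 x)%:E)%E)).
- by apply/measurable_EFinP; apply: measurable_funM => //; exact: measurable_gauss1.
- move=> x _ /=; rewrite lee_fin normrM (ger0_norm (ltW (gauss1_gt0 x))).
  rewrite [leRHS]ger0_norm ?mulr_ge0 ?normal_pdf_ge0//.
  rewrite -mulrA; apply: le_trans (ler_wpM2l c0 (tail x)).
  by rewrite mulrA ler_wpM2r// ltW// gauss1_gt0.
- apply: integrableZl => //; exact: integrable_normal_pdf.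
Qed.

(* [(p' - x p) gauss1] is the derivative of [p gauss1], which vanishes at infinity. *)
Lemma integral_gauss1_ibp (p p' h : R -> R) (c0 c : R) :
  (forall x : R, is_derive x 1 p (p' x)) -> continuous p' ->
  (forall x, `|p x| * `|x| <= c * (1 + x ^+ 4)) ->
  (forall x, `|h x| <= c * (1 + x ^+ 4)) ->
  (forall x, h x = c0 + (p' x - x * p x)) ->
  mu.-integrable setT (EFin \o (fun x => h x * gauss1 x)) /\
  \int[mu]_x (h x * gauss1 x) = c0.
Proof.
move=> dp cp' pb hb hE.
have cp : continuous p.
  by move=> x; apply: differentiable_continuous; apply/derivable1_diffP; have [] := dp x.
have cg : continuous gauss1 by apply: continuous_normal_pdf.
have ch : continuous h.
  move=> x; rewrite (_ : h = fun x => c0 + (p' x - x * p x)); last by apply/funext.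
  apply: cvgD; first exact: cvg_cst.
  apply: cvgB; first exact: cp'.
  by apply: cvgM; [exact: cvg_id|exact: cp].
have mh : measurable_fun [set: RT] h by exact: continuous_measurable_fun.
have ih := integrable_gauss1_poly mh hb.
split=> //.
set f := fun x => (h x - c0) * gauss1 x.
have i0 : mu.-integrable setT (EFin \o (fun x : RT => c0 * gauss1 x)).
  exact: (integrableZl measurableT c0 (@integrable_normal_pdf R 0 1)).
have cf : continuous f.
  move=> x; apply: cvgM; last exact: cg.
  by apply: cvgB; [exact: ch|exact: cvg_cst].
have if_ : mu.-integrable setT (EFin \o f).
  have -> : EFin \o f = ((EFin \o (fun x : RT => (h x * gauss1 x)%R)) \-
      (EFin \o (fun x : RT => (c0 * gauss1 x)%R)))%E.
    by apply/funext => x /=; rewrite -EFinB /f mulrBl.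
  exact: integrableB.
suff f0 : \int[mu]_x f x = 0.
  rewrite (_ : \int[mu]_x _ = \int[mu]_x (f x + c0 * gauss1 x)); last first.
    by apply: eq_Rintegral => x _; rewrite /f -mulrDl subrK.
  rewrite RintegralD// f0 add0r RintegralZl//; last exact: integrable_normal_pdf.
  by rewrite /Rintegral integral_normal_pdf/= mulr1.
set F := fun x => p x * gauss1 x.
have dF (x : R) : is_derive x 1 F (f x).
  have ? := dp x; have ? := is_derive_gauss1 x.
  apply: is_derive_eq; rewrite /f hE /GRing.scale /=; ring.
have ftc n : \int[mu]_(x in `[(- n.+1%:R), n.+1%:R]) f x = F n.+1%:R - F (- n.+1%:R).
  rewrite /Rintegral (@continuous_FTC2 _ _ F)//.
  - by rewrite -subr_gt0 opprK addr_gt0.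
  - by apply: continuous_subspaceT.
  - have cF : continuous F.
      by move=> x; apply: differentiable_continuous; apply/derivable1_diffP; have [] := dF x.
    split.
    + by move=> x _; have [] := dF x.
    + by apply: cvg_at_right_filter; exact: cF.
    + by apply: cvg_at_left_filter; exact: cF.
  - by move=> x _; rewrite derive1E; have [_] := dF x.
have lim0 : (fun n => \int[mu]_(x in `[(- n.+1%:R), n.+1%:R]) f x) @ \oo --> (0 : R).
  under eq_fun do rewrite ftc.
  have [K K0 tail] := tail_pdf.
  pose M := c * (K * normal_peak 2).
  have c_ge0 : 0 <= c.
    by have := hb 0; rewrite expr0n/= addr0 mulr1; apply: le_trans.
  (* The factor [|x|] in the growth hypothesis on [p] makes the boundary terms decay like
     [1 / |x|]. *)
  have FM x : `|F x| * `|x| <= M.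
    rewrite /F normrM (ger0_norm (ltW (gauss1_gt0 x))) mulrAC.
    apply: (@le_trans _ _ (c * (1 + x ^+ 4) * gauss1 x)).
      by rewrite ler_wpM2r// ltW// gauss1_gt0.
    rewrite -mulrA ler_wpM2l// (le_trans (tail x))// ler_wpM2l//.
    exact: normal_pdf_ub.
  have M0 : 0 <= M by apply: le_trans (FM 0); rewrite mulr_ge0.
  have Fn (n : nat) (x : R) : `|x| = n.+1%:R -> `|F x| <= M * harmonic n.
    by move=> xn; rewrite /harmonic /= ler_pdivlMr// -xn.
  apply/norm_cvg0P.
  apply: (@squeeze_cvgr _ _ _ _ (fun=> 0) (fun n => (M + M) * harmonic n)).
  - apply: nearW => n; rewrite normr_ge0/= (le_trans (ler_normB _ _))// mulrDl lerD//.
      by apply: Fn; rewrite ger0_norm.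
    by apply: Fn; rewrite normrN ger0_norm.
  - exact: cvg_cst.
  - rewrite -[X in _ --> X](mulr0 (M + M)); apply: cvgM; first exact: cvg_cst.
    exact: cvg_harmonic.
have limf : (fun n => \int[mu]_(x in `[(- n.+1%:R), n.+1%:R]) f x) @ \oo --> \int[mu]_x f x.
  under eq_fun do rewrite Rintegral_mkcond.
  apply: fine_cvg.
  rewrite fineK; last by apply: integrable_fin_num.
  pose D n : set RT := `[(- n.+1%:R), n.+1%:R]%classic.
  have mf : measurable_fun [set: RT] f by apply: continuous_measurable_fun.
  have [] := @dominated_convergence _ _ _ mu setT measurableT
    (fun n x => ((f \_ (D n)) x)%:E) (EFin \o f) (fun x => `|(f x)%:E|)%E.
  - move=> n; apply/measurable_EFinP.
    have mD : measurable (D n) by exact: measurable_itv.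
    by apply: (measurable_restrictT _ mD).1; exact: measurable_funTS mf.
  - exact/measurable_EFinP.
  - apply/aeW => x _; apply: cvg_EFin; first exact: nearW.
    apply: cvg_near_cst.
    near=> n; rewrite /= /patch /D ifT//= inE /= in_itv/= -ler_norml.
    have : (Num.trunc `|x| <= n)%N by near: n; exists (Num.trunc `|x|).
    by rewrite -ltnS truncn_lt_nat//; exact: ltW.
  - exact: integrable_abse.
  - apply/aeW => x n _ /=; rewrite lee_fin /patch; case: ifP => //.
    by rewrite normr0.
  - by [].
exact: (cvg_unique _ limf lim0).
Unshelve. all: by end_near. Qed.

End gaussian_1d.

Section hermite.
Context {R : realType}.
Local Notation RT := (measurableTypeR R).
Local Notation mu := (@lebesgue_measure R).

(** Probabilists' Hermite polynomials. Every degree above 2 receives the polynomial of degree 2 as a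
    default; the degrees met below are at most 2. *)
Definition hermite (n : nat) (x : R) : R :=
  match n with 0%N => 1 | 1%N => x | _ => x ^+ 2 - 1 end.

Let pow_bound (x : R) : [/\ `|x| <= 1 + x ^+ 4, x ^+ 2 <= 1 + x ^+ 4,
  `|x| ^+ 3 <= 1 + x ^+ 4, 0 <= x ^+ 4 &
  [/\ `|x| ^+ 2 = x ^+ 2, `|x| ^+ 4 = x ^+ 4 & 0 <= `|x|]].
Proof.
have y0 : 0 <= `|x| by [].
have E2 : `|x| ^+ 2 = x ^+ 2 by rewrite real_normK// num_real.
have E4 : `|x| ^+ 4 = x ^+ 4 by rewrite (exprM _ 2 2) E2 -exprM.
rewrite -E4 -E2; set y := `|x| in y0 *.
have h2 : y ^+ 2 <= 1 + y ^+ 4.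
  rewrite -subr_ge0 (_ : _ - _ = (y ^+ 2 - 2^-1) ^+ 2 + 3 / 4); last by field.
  by rewrite addr_ge0 ?sqr_ge0// divr_ge0.
have h1 : 0 <= (y - 1) ^+ 2 by exact: sqr_ge0.
have h3 : 0 <= y ^+ 2 * (y - 1) ^+ 2 by rewrite mulr_ge0 ?sqr_ge0.
have h4 : 0 <= y ^+ 4 by rewrite exprn_ge0.
split => //.
- move: h1 h2 h4; rewrite sqrrB1; lra.
- by move: h3 h2 h4; rewrite (_ : _ * _ = y ^+ 4 - 2 * y ^+ 3 + y ^+ 2); [lra|ring].
Qed.

Lemma integral_hermite a b : (a <= 2)%N -> (b <= 2)%N ->
  mu.-integrable setT (EFin \o (fun x => hermite a x * hermite b x * gauss1 x)) /\
  \int[mu]_x (hermite a x * hermite b x * gauss1 x) = (a == b)%:R * a`!%:R.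
Proof.
wlog ab : a b / (a <= b)%N => [H a2 b2|].
  have [ab|ba] := leqP a b; first exact: H.
  have [h1 h2] := H b a (ltnW ba) b2 a2.
  split; first by under eq_fun do rewrite (mulrC (hermite a _)).
  under eq_Rintegral do rewrite (mulrC (hermite a _)).
  by rewrite h2 eq_sym; case: eqP => [->//|_]; rewrite !mul0r.
have key (h p p' : R -> R) c0 : (forall x : R, is_derive x 1 p (p' x)) -> continuous p' ->
  (forall x, `|p x| * `|x| <= 5 * (1 + x ^+ 4)) ->
  (forall x, `|h x| <= 5 * (1 + x ^+ 4)) ->
  (forall x, h x = c0 + (p' x - x * p x)) ->
  mu.-integrable setT (EFin \o (fun x => h x * gauss1 x)) /\
  \int[mu]_x (h x * gauss1 x) = c0 by apply: integral_gauss1_ibp.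
(* Six cases remain. In each, [p] solves [h = c0 + (p' - x * p)] and is found by matching
   coefficients from the top degree down; the constant left over is the expectation. The growth
   constant 5 is generous. *)
case: a ab => [|[|[|//]]] + _; case: b => [|[|[|//]]] // _ _.
- apply: (key _ (fun=> 0) (fun=> 0)) => [x|x|x|x] /=.
  + exact: cvg_cst.
  + have [] := pow_bound x; rewrite normr0 mul0r; lra.
  + have [] := pow_bound x; rewrite mulr1 normr1; lra.
  + rewrite fact0; ring.
- apply: (key _ (fun=> -1) (fun=> 0)) => [x|x|x|x] /=.
  + exact: cvg_cst.
  + have [] := pow_bound x; rewrite normrN normr1 mul1r; lra.
  + have [] := pow_bound x; rewrite mul1r; lra.
  + ring.
- apply: (key _ (fun x => - x) (fun=> -1)) => [x|x|x|x] /=.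
  + exact: cvg_cst.
  + have [_ h2 _ h4 [h _ _]] := pow_bound x; rewrite normrN -expr2 h; lra.
  + have [_ h2 _ h4 [h _ _]] := pow_bound x; rewrite mul1r.
    have := sqr_ge0 x; rewrite ler_norml; lra.
  + ring.
- apply: (key _ (fun x => - x) (fun=> -1)) => [x|x|x|x] /=.
  + exact: cvg_cst.
  + have [_ h2 _ h4 [h _ _]] := pow_bound x; rewrite normrN -expr2 h; lra.
  + have [_ h2 _ h4 [h _ _]] := pow_bound x.
    have := sqr_ge0 x; rewrite ler_norml; lra.
  + rewrite (_ : 1`! = 1%N)//; ring.
- apply: (key _ (fun x => - x ^+ 2 - 1) (fun x => - (2 * x))) => [x|x|x|x|x] /=.
  + apply: is_derive_eq; rewrite /GRing.scale /=; ring.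
  + apply: (@cvgN _ R^o); apply: cvgM; [exact: cvg_cst|exact: cvg_id].
  + have [h1 h2 h3 h4 [h5 h6 h7]] := pow_bound x.
    rewrite -opprD normrN ger0_norm ?addr_ge0 ?sqr_ge0//.
    by rewrite -h5 mulrDl mul1r -exprSr; lra.
  + have [h1 h2 h3 h4 [h5 h6 h7]] := pow_bound x.
    apply: (@le_trans _ _ (`|x| * (`|x| ^+ 2 + 1))).
      rewrite normrM ler_wpM2l// (le_trans (ler_normB _ _))// normr1 lerD2r.
      by rewrite normrX.
    by rewrite mulrDr mulr1 -exprS; lra.
  + ring.
- apply: (key _ (fun x => - x ^+ 3 - x) (fun x => - (3 * x ^+ 2) - 1)) => [x|x|x|x|x] /=.
  + apply: is_derive_eq; rewrite /GRing.scale /=; ring.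
  + apply: (@cvgB _ R^o); last exact: cvg_cst.
    apply: (@cvgN _ R^o); apply: cvgM; [exact: cvg_cst|exact: sqr_continuous].
  + have [h1 h2 h3 h4 [h5 h6 h7]] := pow_bound x.
    apply: (@le_trans _ _ ((`|x| ^+ 3 + `|x|) * `|x|)).
      rewrite ler_wpM2r// (le_trans (ler_normB _ _))// normrN normrX//.
    by rewrite mulrDl -exprSr -expr2; lra.
  + have [h1 h2 h3 h4 [h5 h6 h7]] := pow_bound x.
    rewrite -expr2 ger0_norm ?sqr_ge0// sqrrB1 -exprM; have := sqr_ge0 x; lra.
  + rewrite (_ : 2`! = 2%N)//; ring.
Qed.

End hermite.

Section gaussian_expectation.
Context {R : realType} {d : nat}.
Local Notation RT := (measurableTypeR R).
Local Notation leb := (@lebesgue_tuple R d).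
Implicit Types (f g : 'cV[R]_d -> R) (z : 'cV[R]_d).

Definition gauss_pdf z : R := \prod_i gauss1 (z i ord0).
Definition meas_Rn f : Prop :=
  measurable_fun [set: d.-tuple RT] (fun t => f (vec_of_tuple t)).
Definition gint f : Prop := integrable_Rn (fun z => f z * gauss_pdf z).
Definition gexp f : R := integral_Rn (fun z => f z * gauss_pdf z).

Lemma gauss_pdf_gt0 z : 0 < gauss_pdf z.
Proof. by apply: prodr_gt0 => i _; exact: gauss1_gt0. Qed.

Lemma meas_gauss_pdf : meas_Rn gauss_pdf.
Proof.
apply: measurable_prod => i _.
rewrite (_ : (fun t => _) = gauss1 \o (@tnth _ _ ^~ i)); last first.
  by apply/funext => t; rewrite /vec_of_tuple mxE.
by apply: measurableT_comp; [exact: measurable_gauss1|exact: measurable_tnth].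
Qed.

(** The density is positive and can be divided out; its inverse is written as [expR (- ln _)], whose
    measurability follows from that of the exponential and of the logarithm. *)
Lemma meas_mul_gauss f : meas_Rn (fun z => f z * gauss_pdf z) -> meas_Rn f.
Proof.
move=> mf.
rewrite /meas_Rn (_ : (fun t => _) =
  fun t => (f (vec_of_tuple t) * gauss_pdf (vec_of_tuple t)) *
    expR (- ln (gauss_pdf (vec_of_tuple t)))); last first.
  apply/funext => t; have gt0 := gauss_pdf_gt0 (vec_of_tuple t).
  by rewrite expRN lnK ?posrE// mulfK// gt_eqF.
apply: measurable_funM => //.
apply: (measurableT_comp (@measurable_expR R)); apply: measurable_funN.
exact: (measurableT_comp (@measurable_ln R) meas_gauss_pdf).
Qed.

Lemma gint_meas f : gint f -> meas_Rn f.
Proof. by move=> /measurable_int/measurable_EFinP; exact: meas_mul_gauss. Qed.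

Lemma gintD f g : gint f -> gint g -> gint (fun z => f z + g z).
Proof.
move=> fi gi; rewrite /gint /integrable_Rn.
under eq_fun do rewrite mulrDl EFinD.
exact: integrableD.
Qed.

Lemma gintZ k f : gint f -> gint (fun z => k * f z).
Proof.
move=> fi; rewrite /gint /integrable_Rn.
under eq_fun do rewrite -mulrA EFinM.
exact: integrableZl.
Qed.

Lemma gexpD f g : gint f -> gint g -> gexp (fun z => f z + g z) = gexp f + gexp g.
Proof.
move=> fi gi; rewrite /gexp /integral_Rn -RintegralD//.
by apply: eq_Rintegral => t _; rewrite mulrDl.
Qed.

Lemma gexpZ k f : gint f -> gexp (fun z => k * f z) = k * gexp f.
Proof.
move=> fi; rewrite /gexp /integral_Rn -RintegralZl//.
by apply: eq_Rintegral => t _; rewrite mulrA.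
Qed.

Lemma gint0 : gint (fun=> 0).
Proof.
rewrite /gint /integrable_Rn; under eq_fun do rewrite mul0r.
exact: integrable0.
Qed.

Lemma gexp0 : gexp (fun=> 0) = 0.
Proof.
rewrite /gexp /integral_Rn; under eq_Rintegral do rewrite mul0r.
by rewrite /Rintegral integral0.
Qed.

Lemma gexp_sum (I : Type) (s : seq I) (P : pred I) (F : I -> 'cV[R]_d -> R) :
  (forall i, gint (F i)) ->
  gint (fun z => \sum_(i <- s | P i) F i z) /\
  gexp (fun z => \sum_(i <- s | P i) F i z) = \sum_(i <- s | P i) gexp (F i).
Proof.
move=> Fi; elim: s => [|i s [IH1 IH2]].
  under eq_fun do rewrite big_nil.
  by rewrite big_nil; split; [exact: gint0|exact: gexp0].
have -> : (fun z => \sum_(j <- i :: s | P j) F j z) =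
   if P i then fun z => F i z + \sum_(j <- s | P j) F j z
   else fun z => \sum_(j <- s | P j) F j z.
  by apply/funext => z; rewrite big_cons; case: ifP.
rewrite big_cons; case: (P i) => //.
by split; [exact: gintD|rewrite gexpD// IH2].
Qed.

Lemma gexp_le f g : gint f -> gint g -> (forall z, f z <= g z) -> gexp f <= gexp g.
Proof.
move=> fi gi fg; apply: le_Rintegral => // t _.
by rewrite ler_wpM2r// ltW// gauss_pdf_gt0.
Qed.

Definition hermite_vec (a : 'I_d -> nat) z : R := \prod_i hermite (a i) (z i ord0).

Lemma gexp_hermite (a b : 'I_d -> nat) :
  (forall i, (a i <= 2)%N) -> (forall i, (b i <= 2)%N) ->
  gint (fun z => hermite_vec a z * hermite_vec b z) /\
  gexp (fun z => hermite_vec a z * hermite_vec b z) =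
    \prod_i ((a i == b i)%:R * (a i)`!%:R).
Proof.
move=> a2 b2.
have H i := @integral_hermite R _ _ (a2 i) (b2 i).
have [] := integral_prod_tuple (fun i => (H i).1).
under eq_bigr do rewrite (H _).2.
have E t : (\prod_i (hermite (a i) (tnth t i) * hermite (b i) (tnth t i) * gauss1 (tnth t i))) =
   hermite_vec a (vec_of_tuple t) * hermite_vec b (vec_of_tuple t) * gauss_pdf (vec_of_tuple t).
  rewrite /hermite_vec /gauss_pdf -!big_split /=.
  by apply: eq_bigr => i _; rewrite /vec_of_tuple !mxE.
move=> h1 h2; split.
  by rewrite /gint /integrable_Rn; under eq_fun do rewrite -E.
rewrite /gexp /integral_Rn /Rintegral.
under eq_integral do rewrite -E.
by rewrite h2.
Qed.

(** The total mass of the Gaussian is the case of the zero multi-index in [gexp_hermite]. *)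
Lemma gexp_cst c : gint (fun=> c) /\ gexp (fun=> c) = c.
Proof.
have [] := @gexp_hermite (fun=> 0%N) (fun=> 0%N).
- by [].
- by [].
under eq_fun do rewrite /hermite_vec big1// mulr1.
under eq_bigr do rewrite eqxx mul1r.
rewrite big1// => h1 h2.
have -> : (fun _ : 'cV[R]_d => c) = (fun z => c * 1) by apply/funext => z; rewrite mulr1.
by split; [exact: gintZ|rewrite gexpZ// h2 mulr1].
Qed.

End gaussian_expectation.

(** * Change of variables from [N(m, C C^T)] to the standard Gaussian *)

Section affine_transfer.
Context {R : realType} {d : nat}.
Local Notation RT := (measurableTypeR R).
Local Notation leb := (@lebesgue_tuple R d).
Implicit Types (f g : 'cV[R]_d -> R) (a z : 'cV[R]_d) (C : 'M[R]_d).

Let aff a C := @tuple_affine R d (fun i => a i ord0) (fun i j => C i j).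

Lemma vec_of_tuple_affine a C t :
  vec_of_tuple (aff a C t) = a + C *m vec_of_tuple t.
Proof.
apply/colP => i; rewrite !mxE tnth_mktuple; congr (_ + _).
by apply: eq_bigr => j _; rewrite mxE.
Qed.

Lemma meas_affine f a C : meas_Rn f -> meas_Rn (fun z => f (a + C *m z)).
Proof.
move=> mf; rewrite /meas_Rn.
under eq_fun do rewrite -vec_of_tuple_affine.
by apply: (measurableT_comp mf); exact: measurable_tuple_affine.
Qed.

Lemma meas_affineV f a C : C \in unitmx -> meas_Rn (fun z => f (a + C *m z)) -> meas_Rn f.
Proof.
move=> Cu /(meas_affine (- (invmx C *m a)) (invmx C)).
rewrite /meas_Rn (_ : (fun t => f (a + _)) = (fun t => f (vec_of_tuple t)))//.
apply/funext => t; congr f.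
by rewrite mulmxDr mulmxN !mulmxA mulmxV// !mul1mx addNKr.
Qed.

(** The formula for nonnegative functions is applied to the absolute value of [f] for the
    equivalence, and to its positive and negative parts for the value. *)
Lemma integrable_Rn_affine f a C : is_trig_mx C -> (forall i, C i i != 0) ->
  meas_Rn f ->
  (integrable_Rn f <-> integrable_Rn (fun z => f (a + C *m z))) /\
  (integrable_Rn f -> integral_Rn f = `|\det C| * integral_Rn (fun z => f (a + C *m z))).
Proof.
move=> Ct C0 mf.
have Clow (i j : 'I_d) : (i < j)%N -> C i j = 0 by move/is_trig_mxP : Ct; apply.
have cpos : 0 < `|\prod_i C i i|.
  by rewrite normr_gt0; apply/prodf_neq0 => i _.
have key (h : d.-tuple RT -> \bar R) : measurable_fun setT h -> (forall t, 0 <= h t)%E ->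
    (\int[leb]_t h t = `|\prod_i C i i|%:E * \int[leb]_t h (aff a C t))%E.
  exact: ge0_integral_tuple_affine.
rewrite det_trig//; set c := `|_| in cpos key *.
have mfa := meas_affine a C mf.
have E : (fun t => f (a + C *m vec_of_tuple t)) = (fun t => f (vec_of_tuple (aff a C t))).
  by apply/funext => t; rewrite vec_of_tuple_affine.
have mEf : measurable_fun [set: d.-tuple RT] (fun t => (f (vec_of_tuple t))%:E).
  exact/measurable_EFinP.
have iffI : integrable_Rn f <-> integrable_Rn (fun z => f (a + C *m z)).
  have mabs := measurableT_comp (@abse_measurable R setT) mEf.
  have keyabs : (\int[leb]_t `|(f (vec_of_tuple t))%:E| =
      c%:E * \int[leb]_t `|(f (a + C *m vec_of_tuple t))%:E|)%E.
    rewrite (key (fun t => `|(f (vec_of_tuple t))%:E|%E) mabs (fun=> abse_ge0 _)).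
    by under [in RHS]eq_integral do rewrite -vec_of_tuple_affine.
  split=> /integrableP[_ fy]; apply/integrableP; split => //.
  - exact/measurable_EFinP.
  - have i0 : (0 <= \int[leb]_t `|(f (a + C *m vec_of_tuple t))%:E|)%E by exact: integral_ge0.
    rewrite ltNge leye_eq; apply/negP => /eqP iy.
    by move: fy; rewrite keyabs iy mulry gtr0_sg// mul1e.
  - by rewrite keyabs; apply: lte_mul_pinfty; rewrite ?lee_fin ?(ltW cpos).
split=> // fi.
have fai := iffI.1 fi.
pose h t := (f (vec_of_tuple t))%:E.
pose k t := (f (a + C *m vec_of_tuple t))%:E.
have kE : k = h \o aff a C.
  by apply/funext => t; rewrite /k /h /= vec_of_tuple_affine.
have kp : (k^\+ = fun t => h^\+ (aff a C t))%E.
  by rewrite kE funepos_comp.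
have kn : (k^\- = fun t => h^\- (aff a C t))%E.
  by rewrite kE funeneg_comp.
have pfin : (\int[leb]_t k^\+ t)%E \is a fin_num.
  by apply: integrable_fin_num => //; exact: integrable_funepos fai.
have nfin : (\int[leb]_t k^\- t)%E \is a fin_num.
  by apply: integrable_fin_num => //; exact: integrable_funeneg fai.
rewrite /integral_Rn /Rintegral -/(h _) -/(k _).
rewrite (integralE _ _ h) (integralE _ _ k).
rewrite (key h^\+%E)//; last exact: measurable_funepos.
rewrite (key h^\-%E)//; last exact: measurable_funeneg.
rewrite -kp -kn -(fineK pfin) -(fineK nfin) -!EFinM -!EFinB /=.
by rewrite mulrBr.
Qed.

Lemma gauss_pdf_sqE z : gauss_pdf z =
  expR (- (z^T *m z) ord0 ord0 / 2) / Num.sqrt ((2 * pi) ^+ d).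
Proof.
rewrite /gauss_pdf; under eq_bigr do rewrite gauss1E.
rewrite big_split /= prodr_const card_ord mulrC -expR_sum; congr (expR _ * _).
  rewrite -mulr_suml sumrN mxE; congr (- _ / _).
  by apply: eq_bigr => i _; rewrite mxE expr2.
rewrite /normal_peak expr1n mul1r -mulr_natl exprVn; congr (_^-1).
have p0 : 0 <= 2 * pi :> R by rewrite mulr_ge0// pi_ge0.
apply/eqP; rewrite -(@eqrXn2 _ 2)//.
by rewrite (sqr_sqrtr (exprn_ge0 _ p0)) exprAC sqr_sqrtr.
Qed.

End affine_transfer.

Section omega.
Context {R : realType} {d : nat}.
Implicit Types (f g : 'cV[R]_d -> R) (z : 'cV[R]_d) (tau : param R d).

Definition tau_aff tau z := tau.1 + tau.2 *m z.

Lemma Omega_det tau : Omega tau -> 0 < \det tau.2.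
Proof. by move=> [Ct C0]; rewrite det_trig//; apply: prodr_gt0. Qed.

Lemma Omega_unit tau : Omega tau -> tau.2 \in unitmx.
Proof. by move=> /Omega_det D; rewrite unitmxE unitfE gt_eqF. Qed.

Lemma ln_det_Omega tau : Omega tau -> ln (\det tau.2) = \sum_i ln (tau.2 i i).
Proof.
move=> [Ct C0]; rewrite det_trig// -[RHS]expRK expR_sum; congr ln.
by apply: eq_bigr => i _; rewrite lnK// posrE.
Qed.

(** The quadratic form [(C z)^T (C C^T)^-1 (C z)] collapses to [z^T z], and the square root of
    [det (C C^T)] is [det C], which is positive on [Omega]. *)
Lemma q_pdf_affine tau z : Omega tau ->
  q_pdf tau (tau_aff tau z) = gauss_pdf z / \det tau.2.
Proof.
move=> Ot; have D := Omega_det Ot; have U := Omega_unit Ot.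
rewrite /q_pdf /gaussian_pdf /tau_aff addrAC subrr add0r gauss_pdf_sqE -mulrA -invfM.
rewrite /cov det_mulmx det_tr -expr2 sqrtrM; last by rewrite exprn_ge0// mulr_ge0// pi_ge0.
rewrite sqrtr_sqr gtr0_norm//; congr (expR (- _ ord0 ord0 / 2) / _).
have UT : tau.2^T \in unitmx by rewrite unitmx_tr.
rewrite trmx_mul -!mulmxA; congr (_ *m _).
rewrite (_ : invmx (_ *m _) = invmx (tau.2^T) *m invmx tau.2); last first.
  have UU : tau.2 *m tau.2^T \in unitmx by rewrite unitmx_mul U.
  apply: (can_inj (mulKmx UU)); rewrite mulmxV//.
  by rewrite -mulmxA (mulmxA tau.2^T) mulmxV// mul1mx mulmxV.
by rewrite !mulmxA mulmxV// mul1mx mulVmx// mul1mx.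
Qed.

Lemma q_expect_affine tau f : Omega tau -> meas_Rn (fun z => f (tau_aff tau z)) ->
  (gint (fun z => f (tau_aff tau z)) <-> q_integrable tau f) /\
  (gint (fun z => f (tau_aff tau z)) -> q_expect tau f = gexp (fun z => f (tau_aff tau z))).
Proof.
move=> Ot mfa; have D := Omega_det Ot; have U := Omega_unit Ot.
have [Ct C0] := Ot.
have E : (fun z => f (tau_aff tau z) * q_pdf tau (tau_aff tau z)) =
    (fun z => (\det tau.2)^-1 * (f (tau_aff tau z) * gauss_pdf z)).
  by apply/funext => z; rewrite q_pdf_affine//; ring.
have mg : meas_Rn (fun x => f x * q_pdf tau x).
  apply: (meas_affineV (a := tau.1) U); rewrite -/(tau_aff tau _) E.
  by apply: measurable_funM => //; apply: measurable_funM => //; exact: meas_gauss_pdf.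
have C0' i : tau.2 i i != 0 by rewrite gt_eqF.
have [h1 h2] := integrable_Rn_affine tau.1 Ct C0' mg.
have E' : (fun z => f (tau.1 + tau.2 *m z) * q_pdf tau (tau.1 + tau.2 *m z)) =
    (fun z => (\det tau.2)^-1 * (f (tau_aff tau z) * gauss_pdf z)) by exact: E.
rewrite E' in h1 h2.
have h3 : gint (fun z => f (tau_aff tau z)) <->
    integrable_Rn (fun z => (\det tau.2)^-1 * (f (tau_aff tau z) * gauss_pdf z)).
  split=> [fi|fi].
    by rewrite /integrable_Rn; under eq_fun do rewrite EFinM; exact: integrableZl.
  rewrite /gint /integrable_Rn.
  rewrite (_ : (fun t => _) = (fun t => (\det tau.2)%:E * ((\det tau.2)^-1 *
     (f (tau_aff tau (vec_of_tuple t)) * gauss_pdf (vec_of_tuple t)))%:E)%E).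
    exact: integrableZl.
  by apply/funext => t; rewrite -EFinM mulrA divff ?gt_eqF// mul1r.
split; first by rewrite h3; rewrite /q_integrable; symmetry.
move=> fi; rewrite /q_expect h2; last by apply/h1/h3.
rewrite gtr0_norm// /integral_Rn RintegralZl//.
by rewrite mulrA divff ?gt_eqF// mul1r.
Qed.

(* As [q_pdf tau] is positive, [f] inherits measurability from [f * q_pdf tau]. *)
Lemma q_integrable_gint tau f : Omega tau -> q_integrable tau f ->
  gint (fun z => f (tau_aff tau z)) /\
  q_expect tau f = gexp (fun z => f (tau_aff tau z)).
Proof.
move=> Ot fi; have D := Omega_det Ot.
have mfa : meas_Rn (fun z => f (tau_aff tau z)).
  have /measurable_EFinP/(meas_affine (f := fun x => f x * q_pdf tau x) tau.1 tau.2) mq := measurable_int _ fi.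
  apply: meas_mul_gauss; rewrite (_ : (fun z => _) =
    fun z => \det tau.2 * (f (tau_aff tau z) * q_pdf tau (tau_aff tau z))).
    by apply: measurable_funM => //; exact: mq.
  by apply/funext => z; rewrite q_pdf_affine//; field; rewrite gt_eqF.
have [h E] := q_expect_affine Ot mfa; have gi := h.2 fi.
by split=> //; exact: E.
Qed.

Definition sign_flip (i : 'I_d) z : 'cV[R]_d :=
  \col_k (if k == i then - z k ord0 else z k ord0).

(** The reflection is a diagonal linear map whose determinant has absolute value 1, and [gauss_pdf]
    is even in each coordinate. *)
Lemma gexp_flip (i : 'I_d) f : gint f ->
  gint (fun z => f (sign_flip i z)) /\ gexp (fun z => f (sign_flip i z)) = gexp f.
Proof.
move=> fi.
pose D : 'M[R]_d := diag_mx (\row_k (if k == i then -1 else 1)).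
have DE z : 0 + D *m z = sign_flip i z.
  apply/colP => k; rewrite add0r /D mul_diag_mx !mxE; case: ifP => _.
    by rewrite mulN1r.
  by rewrite mul1r.
have Dt : is_trig_mx D by apply: diag_mx_is_trig.
have D0 k : D k k != 0.
  by rewrite !mxE eqxx mulr1n; case: ifP => _; rewrite ?oppr_eq0 oner_eq0.
have mg : meas_Rn (fun z => f z * gauss_pdf z).
  apply: measurable_funM; [exact: gint_meas|exact: meas_gauss_pdf].
have [h1 h2] := integrable_Rn_affine 0 Dt D0 mg.
have E : (fun z => f (0 + D *m z) * gauss_pdf (0 + D *m z)) =
    (fun z => f (sign_flip i z) * gauss_pdf z).
  apply/funext => z; rewrite DE; congr (_ * _).
  apply: eq_bigr => k _; rewrite mxE; case: ifP => // _.
  by rewrite !gauss1E sqrrN.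
rewrite E in h1 h2.
split; first exact/h1.
rewrite /gexp h2//.
suff -> : `|\det D| = 1 by rewrite mul1r.
rewrite det_diag normr_prod big1// => k _.
by rewrite mxE; case: ifP => _; rewrite ?normrN normr1.
Qed.

End omega.

(** * Strong convexity *)

Section directional_derivatives.
Context {R : realType} {d : nat}.
Implicit Types (F : 'cV[R]_d -> R) (x v : 'cV[R]_d).

Lemma is_derive_line F x v (t : R) : differentiable F (x + t *: v) ->
  is_derive t 1 (fun s : R => F (x + s *: v)) ('D_v F (x + t *: v)).
Proof.
move=> /diff_derivable => /(_ v) dF.
have E : (fun h : R => h^-1 *: (((fun s : R => F (x + s *: v)) \o shift t) (h *: (1 : R^o)) - F (x + t *: v))) =
  (fun h : R => h^-1 *: ((F \o shift (x + t *: v)) (h *: v) - F (x + t *: v))).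
  apply/funext => h /=; congr (_ *: (F _ - _)).
  by rewrite [h *: 1]mulr1 scalerDl addrCA.
by split; [rewrite /derivable E|rewrite /derive E].
Qed.

Lemma derive_coord F x v : differentiable F x ->
  'D_v F x = \sum_i v i ord0 * 'D_(delta_mx i ord0) F x.
Proof.
move=> dF; rewrite deriveE//.
rewrite [v in LHS](_ : v = \sum_i v i ord0 *: delta_mx i ord0); last first.
  rewrite [LHS]matrix_sum_delta; apply: eq_bigr => i _.
  by rewrite big_ord1.
rewrite linear_sum; apply: eq_bigr => i _.
by rewrite linearZ deriveE.
Qed.

Definition sqnorm x : R := (x^T *m x) ord0 ord0.

Lemma sqnormE x : sqnorm x = \sum_i x i ord0 ^+ 2.
Proof. by rewrite /sqnorm mxE; apply: eq_bigr => i _; rewrite mxE expr2. Qed.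

Lemma sqnorm_ge0 x : 0 <= sqnorm x.
Proof. by rewrite sqnormE sumr_ge0// => i _; rewrite sqr_ge0. Qed.

Lemma loewner_scalar_quad (a : R) (B : 'M[R]_d) v :
  loewner_le a%:M B -> a * sqnorm v <= (v^T *m B *m v) ord0 ord0.
Proof.
move=> /(_ v); rewrite mulmxBr mulmxBl mxE [X in _ + X]mxE subr_ge0.
by rewrite mul_mx_scalar -scalemxAl mxE.
Qed.

End directional_derivatives.

Section strong_convexity.
Context {R : realType} {d : nat} (l : 'cV[R]_d -> R) (delta : R).
Hypothesis l2 : twice_differentiable l.
Hypothesis lconv : forall x, loewner_le delta%:M (hessian l x).
Implicit Types (x v : 'cV[R]_d).

Lemma hessian_quad x v : delta * sqnorm v <= \sum_i \sum_j v i ord0 * v j ord0 * hessian l x i j.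
Proof.
apply: le_trans (loewner_scalar_quad v (lconv x)) _.
rewrite mxE exchange_big /=; apply: ler_sum => j _.
by rewrite mxE mulr_suml; apply: ler_sum => i _; rewrite mxE mulrAC.
Qed.

(** The second derivative along the line [x + t *: v] exists but need not be continuous, so the
    second-order estimate comes from two applications of the mean value theorem instead of an
    integral remainder. *)
Lemma strong_convexity x v :
  l x + 'D_v l x + delta / 2 * sqnorm v <= l (x + v).
Proof.
have [dl dg] := l2.
have dgi i y : differentiable (fun z => gradient l z i ord0) y.
  apply: (@differentiable_comp _ _ _ _ (gradient l) (fun w : 'cV[R]_d => w i ord0)) => //.
  exact: differentiable_coord.
pose phi (t : R) := l (x + t *: v).
pose g (t : R) := 'D_v l (x + t *: v).
pose h (t : R) := \sum_i v i ord0 * 'D_v (fun z => gradient l z i ord0) (x + t *: v).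
have dphi (t : R) : is_derive t 1 phi (g t) by apply: is_derive_line.
have gE : g = fun t => \sum_i v i ord0 * gradient l (x + t *: v) i ord0.
  apply/funext => t; rewrite /g derive_coord//; apply: eq_bigr => i _.
  by rewrite /gradient mxE.
have dgt (t : R) : is_derive t 1 g (h t).
  rewrite gE.
  have -> : (fun t : R => \sum_i v i ord0 * gradient l (x + t *: v) i ord0) =
     \sum_i (fun t : R => v i ord0 * gradient l (x + t *: v) i ord0).
    by apply/funext => s; rewrite fct_sumE.
  apply: is_derive_sum => i.
  have ? := @is_derive_line _ _ _ x v t (dgi i (x + t *: v)).
  by apply: is_derive_eq.
have hge t : delta * sqnorm v <= h t.
  apply: le_trans (hessian_quad (x + t *: v) v) _.
  apply: ler_sum => i _; rewrite derive_coord// mulr_sumr.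
  by apply: ler_sum => j _; rewrite /hessian mxE mulrA.
have cont (u w : R -> R) : (forall t : R, is_derive t 1 u (w t)) -> continuous u.
  by move=> dw t; apply: differentiable_continuous; apply/derivable1_diffP; have [] := dw t.
have gmon t : 0 < t -> g 0 + delta * sqnorm v * t <= g t.
  move=> t0.
  have [c _ E] := @MVT R g h 0 t t0 (fun s _ => dgt s) (continuous_subspaceT (cont _ _ dgt)).
  move: E; rewrite subr0 => E.
  by rewrite -lerBrDl E ler_wpM2r// ltW.
(* Subtracting the quadratic makes the derivative of [psi] at least [g 0] at every positive time, by
   [gmon]. *)
pose psi (t : R) := phi t - delta / 2 * sqnorm v * t ^+ 2.
have dpsi (t : R) : is_derive t 1 psi (g t - delta * sqnorm v * t).
  by apply: is_derive_eq; rewrite /GRing.scale /=; field.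
have [c] := @MVT R psi _ 0 1 ltr01 (fun s _ => dpsi s) (continuous_subspaceT (cont _ _ dpsi)).
rewrite in_itv/= => /andP[c0 _]; rewrite subr0 mulr1 /psi /phi !scale1r scale0r addr0 => E.
have := gmon c c0; rewrite /g scale0r addr0 -/(g c); move: E.
rewrite expr1n expr0n/=; lra.
Qed.

(** The difference quotients of a convex function increase with the step, so the quotient at [h]
    lies between those at [- h0] and [h0]. The bound by a sum of absolute values provides a
    dominating function independent of [h]. *)
Lemma quotient_bound x v (h0 h : R) : 0 <= delta -> 0 < h0 -> `|h| <= h0 -> h != 0 ->
  `| h^-1 * (l (x + h *: v) - l x)| <=
  `| h0^-1 * (l (x + h0 *: v) - l x)| + `| h0^-1 * (l (x - h0 *: v) - l x)|.
Proof.
move=> delta0 h00 hh hn0.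
have [dl dg] := l2.
have conv y w : l y + 'D_w l y <= l (y + w).
  apply: le_trans (strong_convexity y w).
  by rewrite lerDl mulr_ge0 ?sqnorm_ge0// divr_ge0.
have DZ y w (a : R) : 'D_(a *: w) l y = a * 'D_w l y.
  by rewrite !deriveE// linearZ.
have mono w (k : R) : 0 < k -> k <= h0 ->
    'D_w l x <= k^-1 * (l (x + k *: w) - l x) <= h0^-1 * (l (x + h0 *: w) - l x).
  move=> k0 kh; apply/andP; split.
    rewrite ler_pdivlMl//; have := conv x (k *: w); rewrite DZ; lra.
  (* The tangent inequalities at the intermediate point [y], one towards [x] and one towards
     [x + h0 *: w], are combined with weights [h0 - k] and [k] so that the slope at [y] cancels. *)
  pose y := x + k *: w.
  have c1 : l y - k * 'D_w l y <= l x.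
    have := conv y (- k *: w); rewrite DZ /y -addrA -scalerDl subrr scale0r addr0; lra.
  have c2 : l y + (h0 - k) * 'D_w l y <= l (x + h0 *: w).
    have := conv y ((h0 - k) *: w).
    by rewrite DZ /y -addrA -scalerDl addrCA subrr addr0.
  rewrite -/y ler_pdivrMl// mulrCA ler_pdivlMl//.
  have := ler_wpM2l (ltW k0) c2.
  have : (h0 - k) * (l y - k * 'D_w l y) <= (h0 - k) * l x.
    by rewrite ler_wpM2l// subr_ge0.
  nra.
have [hp|hn] := ltP 0 h.
  have hk : h <= h0 by rewrite -(gtr0_norm hp).
  have /andP[a1 a2] := mono v h hp hk.
  have /andP[b1 b2] := mono (- v) h0 h00 (lexx _).
  move: b1; rewrite -scaleN1r DZ scaleN1r scalerN mulN1r => b1.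
  set A := h0^-1 * _ in a2 *; set B := h0^-1 * _ in b1 *.
  rewrite ler_norml; apply/andP; split.
    have := ler_norm B; have := normr_ge0 A; lra.
  have := ler_norm A; have := normr_ge0 B; lra.
have hn' : 0 < - h by rewrite oppr_gt0 lt_neqAle hn0.
have hk : - h <= h0 by rewrite -normrN (gtr0_norm hn') in hh.
have /andP[a1 a2] := mono (- v) (- h) hn' hk.
have /andP[b1 b2] := mono v h0 h00 (lexx _).
move: a1 a2; rewrite -[X in derive _ _ X]scaleN1r DZ mulN1r scaleNr scalerN opprK scalerN => a1 a2.
rewrite invrN mulNr in a1 a2.
set A := h0^-1 * _ in b1 *; set B := h0^-1 * _ in a2 *.
rewrite ler_norml; apply/andP; split.
  have := ler_norm B; have := normr_ge0 A; lra.
have := ler_norm A; have := normr_ge0 B; lra.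
Qed.

End strong_convexity.

(** * Differentiation under the Gaussian expectation *)

Section derivative_under_gexp.
Context {R : realType} {d : nat} (l : 'cV[R]_d -> R) (delta : R).
Hypothesis l2 : twice_differentiable l.
Hypothesis delta0 : 0 <= delta.
Hypothesis lconv : forall x, loewner_le delta%:M (hessian l x).
Variables (x v : 'cV[R]_d -> 'cV[R]_d) (h0 : R).
Hypothesis h0_gt0 : 0 < h0.
Hypothesis gint_l : forall h, `|h| <= h0 -> gint (fun z => l (x z + h *: v z)).

Let Q (h : R) z := h^-1 * (l (x z + h *: v z) - l (x z)).

Let gint_lx : gint (fun z => l (x z)).
Proof.
have := @gint_l 0; rewrite normr0 => /(_ (ltW h0_gt0)).
by under eq_fun do rewrite scale0r addr0.
Qed.

Let gintQ h : `|h| <= h0 -> gint (Q h).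
Proof.
move=> hh; apply: gintZ; apply: gintD; first exact: gint_l.
by under eq_fun do rewrite -mulN1r; apply: gintZ.
Qed.

Let gexpQ h : `|h| <= h0 -> gexp (Q h) =
  h^-1 * (gexp (fun z => l (x z + h *: v z)) - gexp (fun z => l (x z))).
Proof.
move=> hh; rewrite /Q.
have i1 : gint (fun z => - l (x z)) by under eq_fun do rewrite -mulN1r; apply: gintZ.
rewrite gexpZ; last by apply: gintD => //; exact: gint_l.
rewrite gexpD//; last exact: gint_l.
congr (_ * (_ + _)).
by rewrite -[RHS]mulN1r -gexpZ//; congr gexp; apply/funext => z; rewrite mulN1r.
Qed.

Let Q_cvg z (u : nat -> R) : (forall n, u n != 0) -> u @ \oo --> (0 : R) ->
  (fun n => Q (u n) z) @ \oo --> 'D_(v z) l (x z).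
Proof.
move=> u0 ul.
have dl : derivable l (x z) (v z) by apply: diff_derivable; exact: (l2.1 (x z)).
have : (fun h : R => Q h z) @ (0 : R)^' --> 'D_(v z) l (x z).
  rewrite (_ : (fun h : R => Q h z) = (fun h => h^-1 *: ((l \o shift (x z)) (h *: v z) - l (x z)))).
    exact: dl.
  by apply/funext => h; rewrite /Q /= (addrC (h *: v z)).
by move/cvgr_dnbhsP; apply.
Qed.

(* By convexity the difference quotients are dominated by those at [h0] and [- h0]. *)
Lemma gexp_derive :
  gint (fun z => 'D_(v z) l (x z)) /\
  (fun h => h^-1 * (gexp (fun z => l (x z + h *: v z)) - gexp (fun z => l (x z))))
    @ (0 : R)^' --> gexp (fun z => 'D_(v z) l (x z)).
Proof.
pose w (t : d.-tuple (measurableTypeR R)) := gauss_pdf (vec_of_tuple t).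
pose G z := `|Q h0 z| + `|Q (- h0) z|.
have iG : gint G.
  have iabs f : gint f -> gint (fun z => `|f z|).
    move=> fi; have := integrable_abse fi; rewrite /gint /integrable_Rn.
    congr (_.-integrable _ _); apply/funext => t /=.
    by rewrite normrM (ger0_norm (ltW (gauss_pdf_gt0 _))).
  by apply: gintD; apply: iabs; apply: gintQ; rewrite ?normrN gtr0_norm.
have QG (h : R) z : `|h| <= h0 -> h != 0 -> `|Q h z| <= G z.
  move=> hh hn0; apply: le_trans (quotient_bound l2 lconv (x z) (v z) delta0 h0_gt0 hh hn0) _.
  rewrite /G /Q lerD// invrN mulNr normrN scaleNr//.
(* Dominated convergence works along sequences, so the limit over the punctured neighbourhood is
   tested on every sequence tending to 0. *)
have key (u : nat -> R) : (forall n, u n != 0) -> (forall n, `|u n| <= h0) ->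
    u @ \oo --> (0 : R) ->
    gint (fun z => 'D_(v z) l (x z)) /\
    (fun n => gexp (Q (u n))) @ \oo --> gexp (fun z => 'D_(v z) l (x z)).
  move=> u0 uh ul.
  pose f n t := (Q (u n) (vec_of_tuple t) * w t)%:E.
  pose g t := ('D_(v (vec_of_tuple t)) l (x (vec_of_tuple t)) * w t)%:E.
  have mf n : measurable_fun setT (f n) by exact: measurable_int (gintQ (uh n)).
  have fg t : f ^~ t @ \oo --> g t.
    apply: cvg_EFin; first exact: nearW.
    by apply: cvgM; [exact: Q_cvg|exact: cvg_cst].
  (* Measurability of the derivative is inherited from the quotients, of which it is the pointwise
     limit. *)
  have mg : measurable_fun setT g.
    by apply: (emeasurable_fun_cvg f) => // t _; exact: fg.
  have fG : forall t n, setT t -> (`|f n t| <= (G (vec_of_tuple t) * w t)%:E)%E.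
    move=> t n _; rewrite lee_fin normrM (ger0_norm (ltW (gauss_pdf_gt0 _))).
    by rewrite ler_wpM2r ?QG// ltW// gauss_pdf_gt0.
  have [ig _ lim_] := @dominated_convergence _ _ _ (@lebesgue_tuple R d) setT measurableT
    f g (fun t => (G (vec_of_tuple t) * w t)%:E) mf mg (aeW _ (fun t _ => fg t)) iG
    (aeW _ fG).
  split=> //; apply: fine_cvg; rewrite fineK//.
  by apply: integrable_fin_num.
split.
  have [] := key (fun n => h0 * harmonic n).
  - by move=> n; rewrite mulf_neq0 ?gt_eqF//; exact: harmonic_gt0.
  - move=> n; rewrite normrM gtr0_norm// ger0_norm ?harmonic_ge0//.
    by rewrite ler_piMr ?(ltW h0_gt0)// /harmonic /= invf_le1 ?ler1n ?ltr0n.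
  - rewrite -[X in _ --> X](mulr0 h0); apply: cvgM; first exact: cvg_cst.
    exact: cvg_harmonic.
  - by [].
apply/cvgr_dnbhsP => u [u0 ul].
(* An arbitrary sequence enters the range of the domination only eventually; shifting it by [N] does
   not change the limit. *)
have [N _ uN] : \forall n \near \oo, `|u n| <= h0.
  move/cvgrPdist_le : ul => /(_ _ h0_gt0) [N _ H]; exists N => // n /H.
  by rewrite /= sub0r normrN.
have uN' n : `|u (n + N)%N| <= h0 by apply: uN; rewrite /= leq_addl.
rewrite -(cvg_shiftn N) /=.
have [] := key (fun n => u (n + N)%N) (fun n => u0 _) uN'.
  by rewrite (cvg_shiftn N).
move=> _; apply: cvg_trans; apply: near_eq_cvg; apply: nearW => n.
by rewrite gexpQ.
Qed.

End derivative_under_gexp.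

(** * The divergence and its gradient *)

Section coordinates.
Context {R : realType} {d : nat}.
Implicit Types (z : 'cV[R]_d) (tau : param R d) (c : Defs.coord d) (o : option 'I_d).

(** A coordinate is read as an entry of the augmented matrix [[m | C]], where [m] is the column
    [None]. Correspondingly [monomial] gives the components of the augmented vector [(1, z)], so
    that mean and factor coordinates share one set of formulas. *)
Definition coord_row c : 'I_d :=
  match c with inl i => i | inr ij => (val ij).1 end.
Definition coord_col c : option 'I_d :=
  match c with inl _ => None | inr ij => Some (val ij).2 end.
Definition coord_diag c : bool := coord_col c == Some (coord_row c).

Definition monomial o z : R := if o is Some j then z j ord0 else 1.

Lemma monomial_hermite o z : monomial o z = hermite_vec (fun i => nat_of_bool (Some i == o)) z.
Proof.
case: o => [j|]; rewrite /hermite_vec.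
  rewrite (bigD1 j)//= eqxx big1 ?mulr1// => i ij.
  by rewrite (inj_eq Some_inj) (negPf ij).
by rewrite big1.
Qed.

Lemma gexp_monomial o o' : gint (fun z => monomial o z * monomial o' z) /\
  gexp (fun z => monomial o z * monomial o' z) = (o == o')%:R.
Proof.
have [||h1 h2] := @gexp_hermite R d (fun i => nat_of_bool (Some i == o)) (fun i => nat_of_bool (Some i == o')).
- by move=> i; case: (_ == _).
- by move=> i; case: (_ == _).
under eq_fun do rewrite !monomial_hermite.
split=> //; rewrite h2.
have [<-|oo'] := eqVneq o o'.
  by rewrite big1// => i _; rewrite eqxx mul1r; case: (_ == _).
have [i Hi] : exists i : 'I_d, (Some i == o) != (Some i == o').
  case: o oo' {h1 h2} => [j|].
    by exists j; rewrite eqxx eq_sym eqb_id.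
  case: o' => [j _|/eqP//]; exists j; by rewrite eqxx.
rewrite (bigD1 i)//=.
have -> : (nat_of_bool (Some i == o) == nat_of_bool (Some i == o')) = false.
  by apply/negbTE; move: Hi; move: (Some i == o) (Some i == o') => [] [].
by rewrite !mul0r.
Qed.

Lemma gint_sqnorm : gint (@sqnorm R d).
Proof.
rewrite (_ : @sqnorm R d = fun z => \sum_i monomial (Some i) z * monomial (Some i) z).
  have [h _] := @gexp_sum R d _ (index_enum _) predT (fun i z => monomial (Some i) z * monomial (Some i) z)
    (fun i => (gexp_monomial (Some i) (Some i)).1).
  exact: h.
by apply/funext => z; rewrite sqnormE; apply: eq_bigr => i _; rewrite expr2.
Qed.

Lemma gint_ln_gauss_pdf : gint (fun z : 'cV[R]_d => ln (gauss_pdf z)).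
Proof.
have pi0 : 0 < Num.sqrt ((2 * pi) ^+ d) :> R.
  by rewrite sqrtr_gt0 exprn_gt0// mulr_gt0// pi_gt0.
have -> : (fun z : 'cV[R]_d => ln (gauss_pdf z)) =
  (fun z => (- 2^-1) * sqnorm z + - ln (Num.sqrt ((2 * pi) ^+ d))).
  apply/funext => z; rewrite gauss_pdf_sqE ln_div ?posrE ?expR_gt0// expRK /sqnorm.
  by rewrite mulNr mulrC mulNr.
apply: gintD; last exact: (gexp_cst _).1.
by apply: gintZ; exact: gint_sqnorm.
Qed.

(** The summands are in this order so that the value is convertible to the argument of the
    difference quotient in ['D_]. *)
Definition shift_coord tau c (h : R) : param R d :=
  (h *: (coord_dir R c).1 + tau.1, h *: (coord_dir R c).2 + tau.2).

Lemma tau_aff_shift tau c (h : R) z : tau_aff (shift_coord tau c h) z =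
  tau_aff tau z + h *: (monomial (coord_col c) z *: delta_mx (coord_row c) ord0).
Proof.
rewrite /tau_aff /shift_coord /=.
case: c => [i|[[i j] ij]] /=.
  by rewrite scaler0 add0r scale1r -addrA addrC.
rewrite scaler0 add0r mulmxDl addrCA addrC; congr (_ + _).
rewrite -scalemxAl; congr (_ *: _).
apply/colP => k; rewrite !mxE (bigD1 j)//= big1 ?addr0.
  by rewrite mxE eqxx andbT mulrC.
by move=> m mj; rewrite mxE (negPf mj) andbF mul0r.
Qed.

Lemma shift_coord_diag tau c (h : R) i :
  (shift_coord tau c h).2 i i = tau.2 i i + h * (coord_diag c && (i == coord_row c))%:R.
Proof.
rewrite /shift_coord /coord_diag /= !mxE addrC; congr (_ + _ * _).
case: c => [k|[[k j] kj]] /=; first by rewrite mxE.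
rewrite mxE (inj_eq Some_inj); case: (eqVneq i k) => [->|_] /=.
  by rewrite andbT eq_sym.
by rewrite andbF.
Qed.

Lemma Omega_shift tau c : Omega tau ->
  exists2 h0 : R, 0 < h0 & forall h, `|h| <= h0 -> Omega (shift_coord tau c h).
Proof.
(* Half of the diagonal entry in the row of [c] is a radius that keeps this entry positive; the
   other diagonal entries do not move. *)
move=> [Ct C0]; exists (tau.2 (coord_row c) (coord_row c) / 2).
  by rewrite divr_gt0.
move=> h hh; split; last first.
  move=> i; rewrite shift_coord_diag; case: andP => [[_ /eqP ->]|_].
    have := C0 (coord_row c); move: hh; rewrite ler_norml mulr1; lra.
  by rewrite mulr0 addr0.
apply/is_trig_mxP => i j ij; rewrite /shift_coord /= !mxE.
move/is_trig_mxP : Ct => -> //; rewrite addr0.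
case: c {hh} => [k|[[k m] km]] /=; first by rewrite mxE mulr0.
rewrite mxE; case: (eqVneq i k) => [ik|_]; last by rewrite mulr0.
case: (eqVneq j m) => [jm|_]; last by rewrite mulr0.
by move: km ij; rewrite /= -ik -jm ltnNge => ->.
Qed.

Lemma cvg_sum_ln_shift tau c : Omega tau ->
  (fun h : R => h^-1 * (\sum_i ln ((shift_coord tau c h).2 i i) - \sum_i ln (tau.2 i i)))
    @ (0 : R)^' --> (coord_diag c)%:R / tau.2 (coord_row c) (coord_row c).
Proof.
move=> [Ct C0]; set r := coord_row c.
have dln : is_derive (tau.2 r r) 1 (@ln R) (tau.2 r r)^-1 by apply: is_derive1_ln.
have : (fun h : R => (coord_diag c)%:R * (h^-1 * (ln (h + tau.2 r r) - ln (tau.2 r r)))) @ (0 : R)^'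
   --> (coord_diag c)%:R / tau.2 r r.
  apply: cvgM; first exact: cvg_cst.
  have [dd de] := dln.
  rewrite -de; move: dd; rewrite /derivable /derive /=.
  under [X in cvg (fmap X _) -> _]eq_fun do rewrite [_ *: 1]mulr1.
  under [X in _ -> fmap _ _ --> lim (fmap X _)]eq_fun do rewrite [_ *: 1]mulr1.
  exact.
apply: cvg_trans; apply: near_eq_cvg; apply: nearW => h.
rewrite mulrCA; congr (_ * _).
rewrite -sumrB (bigD1 r)//= big1 ?addr0; last first.
  by move=> i ir; rewrite shift_coord_diag (negPf ir) andbF mulr0 addr0 subrr.
rewrite shift_coord_diag eqxx andbT; case: (coord_diag c) => /=.
  by rewrite mul1r mulr1 (addrC h).
by rewrite mul0r mulr0 addr0 subrr.
Qed.

End coordinates.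

Section KL_formula.
Context {R : realType} {d : nat} (l : 'cV[R]_d -> R) (delta : R).
Implicit Types (z : 'cV[R]_d) (tau : param R d) (c : Defs.coord d).
Hypothesis l2 : twice_differentiable l.
Hypothesis delta0 : 0 <= delta.
Hypothesis lconv : forall x, loewner_le delta%:M (hessian l x).
Hypothesis KL_finite : forall tau, Omega tau -> integrable_Rn (KL_integrand tau (posterior l)).
Let Z := integral_Rn (fun y => expR (- l y)).
Hypothesis Z0 : 0 < Z.

Let ratio tau x := ln (q_pdf tau x / posterior l x).

Let ratioE tau z : Omega tau ->
  ratio tau (tau_aff tau z) = ln (gauss_pdf z) + l (tau_aff tau z) + (ln Z - ln (\det tau.2)).
Proof.
move=> Ot; rewrite /ratio q_pdf_affine// /posterior -/Z.
have D := Omega_det Ot; have g0 := gauss_pdf_gt0 z.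
have e0 := expR_gt0 (- l (tau_aff tau z)).
rewrite ln_div ?posrE ?divr_gt0// ln_div ?posrE// ln_div ?posrE// expRK; ring.
Qed.

Let q_ratio tau : Omega tau -> q_integrable tau (ratio tau).
Proof.
move=> /KL_finite; rewrite /q_integrable; congr integrable_Rn.
by apply/funext => x; rewrite /KL_integrand mulrC.
Qed.

(** At [m + C z] the logarithmic ratio inside the divergence is [l] plus [ln (gauss_pdf z)] plus a
    constant. The ratio is integrable because the divergence is finite, the last two terms because
    they are quadratic in [z], so [l] is integrable as well. *)
Lemma gint_posterior tau : Omega tau -> gint (fun z => l (tau_aff tau z)).
Proof.
move=> Ot; have [Ct C0] := Ot.
have [gr _] := q_integrable_gint Ot (q_ratio Ot).
rewrite (_ : (fun z => _) = fun z => ratio tau (tau_aff tau z) +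
    ((-1) * ln (gauss_pdf z) + - (ln Z - ln (\det tau.2)))).
  apply: gintD => //; apply: gintD; last exact: (gexp_cst _).1.
  by apply: gintZ; exact: gint_ln_gauss_pdf.
by apply/funext => z; rewrite ratioE//; ring.
Qed.

Lemma KL_posteriorE tau : Omega tau -> KL (posterior l) tau =
  gexp (fun z => l (tau_aff tau z)) - \sum_i ln (tau.2 i i) +
  (gexp (fun z : 'cV[R]_d => ln (gauss_pdf z)) + ln Z).
Proof.
move=> Ot; have [Ct C0] := Ot.
have gl := gint_posterior Ot.
have [_] := q_integrable_gint Ot (q_ratio Ot).
have -> : q_expect tau (ratio tau) = KL (posterior l) tau.
  by congr integral_Rn; apply/funext => x; rewrite /KL_integrand mulrC.
move=> ->.
under eq_fun do rewrite ratioE//.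
rewrite gexpD; first last.
- exact: (gexp_cst _).1.
- by apply: gintD => //; exact: gint_ln_gauss_pdf.
rewrite gexpD//; last exact: gint_ln_gauss_pdf.
rewrite (gexp_cst _).2 ln_det_Omega//; ring.
Qed.

Lemma grad_KL tau c : Omega tau ->
  gint (fun z => monomial (coord_col c) z * gradient l (tau_aff tau z) (coord_row c) ord0) /\
  'D_(coord_dir R c) (KL (posterior l)) tau =
   gexp (fun z => monomial (coord_col c) z * gradient l (tau_aff tau z) (coord_row c) ord0)
   - (coord_diag c)%:R / tau.2 (coord_row c) (coord_row c).
Proof.
move=> Ot; have [Ct C0] := Ot.
have [h0 h00 Oh] := Omega_shift c Ot.
pose v z : 'cV[R]_d := monomial (coord_col c) z *: delta_mx (coord_row c) ord0.
have gh h : `|h| <= h0 -> gint (fun z => l (tau_aff tau z + h *: v z)).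
  move=> /Oh /gint_posterior; by under eq_fun do rewrite tau_aff_shift.
have [g1 g2] := gexp_derive l2 delta0 lconv h00 gh.
have E : (fun z => 'D_(v z) l (tau_aff tau z)) =
   fun z => monomial (coord_col c) z * gradient l (tau_aff tau z) (coord_row c) ord0.
  apply/funext => z; rewrite /gradient mxE /v.
  have dl := l2.1 (tau_aff tau z).
  by rewrite !deriveE// linearZ.
rewrite E in g1 g2; split => //.
set r := coord_row c in g2 *.
pose D (h : R) := h^-1 * (gexp (fun z => l (tau_aff tau z + h *: v z)) - gexp (fun z => l (tau_aff tau z)))
   - h^-1 * (\sum_i ln ((shift_coord tau c h).2 i i) - \sum_i ln (tau.2 i i)).
have Dln := @cvg_sum_ln_shift _ _ tau c Ot.
have DD : D @ (0 : R)^' --> gexp (fun z => monomial (coord_col c) z * gradient l (tau_aff tau z) r ord0)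
   - (coord_diag c)%:R / tau.2 r r by apply: cvgB.
apply: cvg_lim => //.
apply: cvg_trans DD; apply: near_eq_cvg.
near=> h.
have hh : `|h| <= h0 by near: h; exact: dnbhs0_le.
have -> : (KL (posterior l) \o shift tau) (h *: coord_dir R c) = KL (posterior l) (shift_coord tau c h) by [].
rewrite /D !KL_posteriorE//; last exact: Oh.
under [in RHS]eq_fun do rewrite tau_aff_shift -/(v _).
by rewrite /GRing.scale /=; ring.
Unshelve. all: by end_near. Qed.

End KL_formula.

(** * The Fisher matrix *)

Section triangular.
Context {R : realType} {d : nat}.
Implicit Types (C : 'M[R]_d).

(** Forward substitution: row [i] of [C *m invmx C = 1] expresses entry [(i, j)] of the inverse
    through rows above [i]. The strong induction on [i] is phrased with a bound [n]. *)
Lemma invmx_trig C : is_trig_mx C -> (forall i, C i i != 0) ->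
  is_trig_mx (invmx C) /\ forall i, invmx C i i = (C i i)^-1.
Proof.
move=> Ct C0; have /is_trig_mxP Clow := Ct.
have U : C \in unitmx.
  by rewrite unitmxE unitfE det_trig//; apply/prodf_neq0.
have row i j : \sum_k C i k * invmx C k j = (i == j)%:R.
  by have /matrixP/(_ i j) := mulmxV U; rewrite !mxE.
have low : forall n (i j : 'I_d), (i < n)%N -> (i < j)%N -> invmx C i j = 0.
  elim=> [//|n IH] i j iN ij.
  have := row i j; rewrite (bigD1 i)//= big1 ?addr0.
    rewrite (_ : (i == j) = false); last by apply/negbTE; rewrite -val_eqE /= ltn_eqF.
    by move=> /eqP; rewrite mulf_eq0 (negPf (C0 i)) => /eqP.
  move=> k ki; have [ik|ki'] := ltnP i k; first by rewrite Clow// mul0r.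
  have ki2 : (k < i)%N by rewrite ltn_neqAle ki'; move: ki; rewrite -val_eqE => ->.
  by rewrite IH ?mulr0//; [exact: leq_trans ki2 _ | exact: ltn_trans ki2 ij].
split; first by apply/is_trig_mxP => i j ij; apply: (low i.+1).
move=> i; apply: (mulfI (C0 i)); rewrite divff//.
have := row i i; rewrite (bigD1 i)//= big1 ?addr0 ?eqxx//.
move=> k ki; have [ik|ki'] := ltnP i k; first by rewrite Clow// mul0r.
by rewrite (low k.+1) ?mulr0// ltn_neqAle ki'; move: ki; rewrite -val_eqE => ->.
Qed.

End triangular.

Section coord_sums.
Context {d : nat}.
Implicit Types (c : Defs.coord d).

Lemma coord_inj c c' : coord_row c = coord_row c' -> coord_col c = coord_col c' -> c = c'.
Proof.
case: c c' => [i|p] [i'|p'] //=; first by move=> ->.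
move=> h1 [h2]; congr inr; apply: val_inj.
by rewrite (surjective_pairing (val p)) h1 h2 -surjective_pairing.
Qed.

Lemma coord_col_le c j : coord_col c = Some j -> (j <= coord_row c)%N.
Proof. by case: c => [//|p] /= [<-]; exact: valP p. Qed.

Lemma coord_mk c (k : 'I_d) : (coord_row c <= k)%N ->
  exists2 c', coord_row c' = k & coord_col c' = coord_col c.
Proof.
case: c => [i|p] /= ck; first by exists (inl k).
have H : ((k, (val p).2).2 <= (k, (val p).2).1)%N by exact: leq_trans (valP p) ck.
by exists (inr (exist _ (k, (val p).2) H)).
Qed.

(** The coordinates in one column fill a final segment of rows that contains all rows from
    [coord_row c] on, and [g] vanishes on the earlier ones. This turns sums over coordinates into
    full matrix products when a triangular factor is present. *)
Lemma sum_same_col (V : nmodType) c (g : 'I_d -> V) :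
  (forall k : 'I_d, (k < coord_row c)%N -> g k = 0) ->
  \sum_(c' | coord_col c' == coord_col c) g (coord_row c') = \sum_k g k.
Proof.
move=> g0; rewrite (partition_big (@coord_row d) predT)//=.
apply: eq_bigr => k _.
have [kc|ck] := ltnP k (coord_row c).
  by rewrite g0// big1// => c' /andP[_ /eqP ->]; rewrite g0.
have [c' rk cc] := coord_mk ck.
rewrite (big_pred1 c') ?rk// => c2; apply/andP/eqP => [[/eqP h1 /eqP h2]|->].
  by apply: coord_inj; rewrite ?h1 ?h2.
by rewrite rk cc !eqxx.
Qed.

End coord_sums.

Section fisher.
Context {R : realType} {d : nat}.
Implicit Types (z : 'cV[R]_d) (tau : param R d) (c : Defs.coord d).

Definition coord_hermite c z := hermite_vec (fun i => (i == coord_row c) + (Some i == coord_col c))%N z.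

Lemma coord_hermiteE c z :
  coord_hermite c z = z (coord_row c) ord0 * monomial (coord_col c) z - (coord_diag c)%:R.
Proof.
rewrite /coord_hermite /hermite_vec (bigD1 (coord_row c))//= eqxx /coord_diag.
case E: (coord_col c) => [j|] /=; last first.
  by rewrite big1 ?mulr1 ?subr0// => i /negPf ->.
rewrite !(inj_eq Some_inj); have [->|rj] := eqVneq (coord_row c) j.
  rewrite ?eqxx big1 /= ?mulr1 ?expr2// => i /negPf ij.
  by rewrite (inj_eq Some_inj) ij.
rewrite addn0 subr0 /=; congr (_ * _).
have jr : j != coord_row c by rewrite eq_sym.
rewrite (bigD1 j)//= eqxx (negPf jr) big1 ?mulr1// => i /andP[/negPf ir /negPf ij].
by rewrite (inj_eq Some_inj) ir ij.
Qed.

(** Distinct coordinates have distinct multi-indices: an unordered pair of indices occurs only once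
    below the diagonal. The norm is [2! = 2] on the diagonal and 1 elsewhere. *)
Lemma gexp_coord_hermite c c' :
  gint (fun z => coord_hermite c z * coord_hermite c' z) /\
  gexp (fun z => coord_hermite c z * coord_hermite c' z) =
    (c == c')%:R * (1 + coord_diag c)%:R.
Proof.
pose al c (i : 'I_d) := ((i == coord_row c) + (Some i == coord_col c))%N.
have al2 c0 i : (al c0 i <= 2)%N by rewrite /al; case: (_ == _); case: (_ == _).
have [h1 h2] := @gexp_hermite R d _ _ (al2 c) (al2 c').
split; first exact: h1.
rewrite /coord_hermite h2.
have [<-|cc'] := eqVneq c c'.
  rewrite mul1r (bigD1 (coord_row c))//= eqxx mul1r big1 ?mulr1.
    by rewrite /al eqxx /coord_diag (eq_sym (coord_col c)); case: (_ == _).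
  by move=> i /negPf ir; rewrite eqxx mul1r /al ir; case: (_ == _).
rewrite mul0r.
have [i ali] : exists i, al c i != al c' i.
  apply/existsP; apply: contraNT cc'; rewrite negb_exists => /forallP al_eq.
  have {}al_eq i : al c i = al c' i by apply/eqP; have := al_eq i; rewrite negbK.
  (* The row of a coordinate is the largest index in the support of its multi-index, hence is
     determined by it. *)
  have rle c1 c2 : (forall i, al c1 i = al c2 i) -> (coord_row c1 <= coord_row c2)%N.
    move=> /(_ (coord_row c1)); rewrite {1}/al eqxx /al.
    case: (eqVneq (coord_row c1) (coord_row c2)) => [->//|_].
    case: (eqVneq (Some (coord_row c1)) (coord_col c2)) => [E _|//].
    by rewrite (coord_col_le (esym E)).
  have rr : coord_row c = coord_row c'.
    by apply/val_inj/eqP; rewrite eqn_leq !rle.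
  have ce i : (Some i == coord_col c) = (Some i == coord_col c').
    have := al_eq i; rewrite /al rr => /addnI.
    by do 2 case: (_ == _).
  apply/eqP; apply: coord_inj => //.
  case E: (coord_col c) (ce) => [j|] h.
    by have := h j; rewrite eqxx => /esym/eqP.
  case E': (coord_col c') h => [j|//] h.
  by have := h j; rewrite eqxx.
by rewrite (bigD1 i)//= (negPf ali) !mul0r.
Qed.

(* Adding [h] to the coordinate [c] of [tau] moves the preimage of a fixed point
   from [z] to [z - s h *: e] (Sherman-Morrison formula). *)
Lemma score_affine tau c z : Omega tau ->
  'D_(coord_dir R c) (fun tau' => ln (q_pdf tau' (tau_aff tau z))) tau =
  (\sum_k invmx tau.2 k (coord_row c) * z k ord0) * monomial (coord_col c) z
  - (coord_diag c)%:R / tau.2 (coord_row c) (coord_row c).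
Proof.
move=> Ot; have [Ct C0] := Ot; have U := Omega_unit Ot.
set r := coord_row c; set m := monomial _ z.
pose e : 'cV[R]_d := invmx tau.2 *m delta_mx r ord0.
pose kap : R := if coord_col c is Some j then e j ord0 else 0.
(* This solves [s = h * (m - s * kap)]: the shift of the parameter must undo the move along [e]
   exactly, and that shift is itself evaluated at the moved point. *)
pose s (h : R) := h * m / (1 + h * kap).
have [h0 h00 Oh] := Omega_shift c Ot.
have mono h : monomial (coord_col c) (z - s h *: e) = m - s h * kap.
  by rewrite /m /kap; case: (coord_col c) => [j|] /=; rewrite ?mxE ?mulr0 ?subr0// !mxE.
have shiftE h : 1 + h * kap != 0 -> tau_aff (shift_coord tau c h) (z - s h *: e) = tau_aff tau z.
  move=> hk; rewrite tau_aff_shift mono /tau_aff mulmxBr -scalemxAr /e mulKVmx//.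
  rewrite scalerA -/r !addrA -[LHS]addrA -scaleNr -scalerDl.
  rewrite (_ : - s h + h * (m - s h * kap) = 0) ?scale0r ?addr0//.
  by rewrite /s; field.
pose A := \sum_k invmx tau.2 k r * z k ord0.
have eE k : e k ord0 = invmx tau.2 k r.
  rewrite mxE (bigD1 r)//= mxE !eqxx mulr1 big1 ?addr0// => i ir.
  by rewrite mxE (negPf ir) mulr0.
have sq t : sqnorm (z - t *: e) = sqnorm z - 2 * t * A + t ^+ 2 * sqnorm e.
  rewrite !sqnormE /A !mulr_sumr -sumrB -big_split /=; apply: eq_bigr => k _.
  by rewrite !mxE -eE [e k _]mxE; ring.
have lnE h : Omega (shift_coord tau c h) -> 1 + h * kap != 0 ->
    ln (q_pdf (shift_coord tau c h) (tau_aff tau z)) =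
    ln (gauss_pdf (z - s h *: e)) - \sum_i ln ((shift_coord tau c h).2 i i).
  move=> Sh hk; rewrite -(shiftE h hk) q_pdf_affine//.
  by rewrite ln_div ?posrE ?gauss_pdf_gt0 ?Omega_det// ln_det_Omega.
have pi0 : 0 < Num.sqrt ((2 * pi) ^+ d) :> R.
  by rewrite sqrtr_gt0 exprn_gt0// mulr_gt0// pi_gt0.
have lng (y : 'cV[R]_d) : ln (gauss_pdf y) = - sqnorm y / 2 - ln (Num.sqrt ((2 * pi) ^+ d)).
  by rewrite gauss_pdf_sqE ln_div ?posrE ?expR_gt0// expRK.
(* The difference quotient after expanding the squared norm and cancelling [h] in the quadratic
   terms. *)
pose D (h : R) := m / (1 + h * kap) * A - m / (1 + h * kap) * s h * sqnorm e / 2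
   - h^-1 * (\sum_i ln ((shift_coord tau c h).2 i i) - \sum_i ln (tau.2 i i)).
have c1 : (fun h : R => 1 + h * kap) @ (0 : R)^' --> (1 : R).
  rewrite -[X in _ --> X]addr0 -[X in _ --> _ + X](mul0r kap).
  apply: cvgD; first exact: cvg_cst.
  by apply: cvgM; [exact: cvg_within|exact: cvg_cst].
have ci : (fun h : R => m / (1 + h * kap)) @ (0 : R)^' --> m.
  rewrite -[X in _ --> X]divr1.
  by apply: cvgM; [exact: cvg_cst|apply: cvgV => //; exact: oner_neq0].
have cs : s @ (0 : R)^' --> (0 : R).
  rewrite -[X in _ --> X](mul0r m) /s; under eq_fun do rewrite -mulrA.
  by apply: cvgM => //; exact: cvg_within.
have DD : D @ (0 : R)^' --> A * m - (coord_diag c)%:R / tau.2 r r.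
  apply: cvgB; last exact: cvg_sum_ln_shift.
  rewrite -[X in _ --> X]subr0; apply: cvgB.
    by rewrite mulrC; apply: cvgM => //; exact: cvg_cst.
  rewrite -[X in _ --> X](mul0r 2^-1); apply: cvgM; last exact: cvg_cst.
  rewrite -[X in _ --> X](mul0r (sqnorm e)); apply: cvgM; last exact: cvg_cst.
  by rewrite -[X in _ --> X](mulr0 m); apply: cvgM.
apply: cvg_lim => //.
apply: cvg_trans DD; apply: near_eq_cvg.
near=> h.
have hh : `|h| <= h0 by near: h; exact: dnbhs0_le.
have hn0 : h != 0 by near: h; exact: nbhs_dnbhs_neq.
have hk : 1 + h * kap != 0.
  near: h; have : \forall h \near (0 : R)^', 0 < 1 + h * kap.
    by apply: (cvgr_gt 1 c1); exact: ltr01.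
  by apply: filterS => h /gt_eqF ->.
have -> : ((fun tau' => ln (q_pdf tau' (tau_aff tau z))) \o shift tau) (h *: coord_dir R c)
  = ln (q_pdf (shift_coord tau c h) (tau_aff tau z)) by [].
rewrite lnE//; last exact: Oh.
rewrite q_pdf_affine// ln_div ?posrE ?gauss_pdf_gt0 ?Omega_det// ln_det_Omega//.
rewrite !lng sq /D /GRing.scale /= /s.
by field; rewrite hn0 hk.
Unshelve. all: by end_near. Qed.

End fisher.

Section fisher_matrix.
Context {R : realType} {d : nat}.
Implicit Types (z : 'cV[R]_d) (tau : param R d) (c : Defs.coord d).
Local Notation N := #|Defs.coord d|.

Lemma sum_enum_val (F : Defs.coord d -> R) : \sum_(a < N) F (enum_val a) = \sum_c F c.
Proof. by rewrite (reindex (fun a : 'I_N => enum_val a))//; exact: onW_bij (enum_val_bij _). Qed.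

(** The constant -1 of a squared term occurs only in row [k = j] for a coordinate in column [j]. Its
    coefficient there is entry [(j, r)] of the triangular inverse, with [r] the row of [c] and
    [j <= r], so it vanishes unless [j = r] and is then [1 / C_rr], the logarithmic term of the
    score. *)
Lemma score_hermite tau c z : Omega tau ->
  'D_(coord_dir R c) (fun tau' => ln (q_pdf tau' (tau_aff tau z))) tau =
  \sum_(c' | coord_col c' == coord_col c)
    invmx tau.2 (coord_row c') (coord_row c) * coord_hermite c' z.
Proof.
move=> Ot; have [Ct C0] := Ot.
have [/is_trig_mxP Xlow Xd] : is_trig_mx (invmx tau.2) /\ forall i, invmx tau.2 i i = (tau.2 i i)^-1.
  by apply: invmx_trig => // i; rewrite gt_eqF.
set X := invmx tau.2 in Xlow Xd *.
rewrite score_affine//.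
pose g (k : 'I_d) := X k (coord_row c) * (z k ord0 * monomial (coord_col c) z - (coord_col c == Some k)%:R).
rewrite (eq_bigr (fun c' => g (coord_row c'))); last first.
  by move=> c' /eqP cc; rewrite coord_hermiteE /coord_diag cc.
rewrite sum_same_col; last by move=> k kc; rewrite /g Xlow// mul0r.
rewrite /g; under [RHS]eq_bigr do rewrite mulrBr.
rewrite sumrB mulr_suml; congr (_ - _).
  by apply: eq_bigr => k _; rewrite mulrA.
rewrite (bigD1 (coord_row c))//= Xd mulrC big1 ?addr0// => k kc.
case: eqP => [ck|_]; last by rewrite mulr0.
rewrite Xlow ?mul0r// ltn_neqAle (coord_col_le ck).
by move: kc; rewrite -val_eqE => ->.
Qed.

(* Matrix, on gradients, of the transpose of [(u, B) |-> (X u, X B)]; it respects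
   the lower triangular coordinates only when [X] is lower triangular. *)
Definition coord_action (X : 'M[R]_d) : 'M[R]_N :=
  \matrix_(a, b) ((coord_col (enum_val b) == coord_col (enum_val a))%:R *
    X (coord_row (enum_val b)) (coord_row (enum_val a))).

Lemma sum_coord_action (X : 'M[R]_d) a (F : Defs.coord d -> R) :
  \sum_b coord_action X a b * F (enum_val b) =
  \sum_(c' | coord_col c' == coord_col (enum_val a)) X (coord_row c') (coord_row (enum_val a)) * F c'.
Proof.
under eq_bigr do rewrite mxE.
rewrite (sum_enum_val (fun c' => (coord_col c' == coord_col (enum_val a))%:R *
   X (coord_row c') (coord_row (enum_val a)) * F c')).
rewrite [RHS]big_mkcond; apply: eq_bigr => c' _.
by case: ifP => _; rewrite ?mul1r// !mul0r.
Qed.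

(** Being a transpose, the action reverses products; triangularity of [X] makes the sum over one
    column of coordinates equal to the full product [Y *m X]. *)
Lemma coord_actionM (X Y : 'M[R]_d) : is_trig_mx X -> Y *m X = 1%:M ->
  coord_action X *m coord_action Y = 1%:M.
Proof.
move=> /is_trig_mxP Xlow YX; apply/matrixP => a b; rewrite !mxE.
pose F c := (coord_col (enum_val b) == coord_col c)%:R * Y (coord_row (enum_val b)) (coord_row c).
rewrite (eq_bigr (fun k => coord_action X a k * F (enum_val k))); last first.
  by move=> k _; rewrite [X in _ * X]mxE.
rewrite sum_coord_action.
pose g (k : 'I_d) := X k (coord_row (enum_val a)) *
  ((coord_col (enum_val b) == coord_col (enum_val a))%:R * Y (coord_row (enum_val b)) k).
rewrite (eq_bigr (fun c' => g (coord_row c'))); last first.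
  by move=> c' /eqP cc; rewrite /F cc.
rewrite sum_same_col; last by move=> k kc; rewrite /g Xlow// mul0r.
have /matrixP/(_ (coord_row (enum_val b)) (coord_row (enum_val a))) := YX.
rewrite !mxE => YXE.
transitivity ((coord_col (enum_val b) == coord_col (enum_val a))%:R *
  (coord_row (enum_val b) == coord_row (enum_val a))%:R : R).
  by rewrite -YXE mulr_sumr; apply: eq_bigr => k _; rewrite /g; ring.
rewrite -natrM mulnb; congr (nat_of_bool _)%:R.
apply/andP/eqP => [[/eqP h1 /eqP h2]|->]; last by rewrite !eqxx.
by apply: enum_val_inj; exact: coord_inj.
Qed.

Definition fisher_weight : 'rV[R]_N := \row_a (1 + coord_diag (enum_val a))%:R.

Lemma fisherE tau : Omega tau -> fisher tau =
  coord_action (invmx tau.2) *m diag_mx fisher_weight *m (coord_action (invmx tau.2))^T.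
Proof.
move=> Ot; apply/matrixP => a b.
set X := invmx tau.2; set M := coord_action X.
rewrite [LHS]mxE.
have sE k z : score tau (tau_aff tau z) k ord0 = \sum_i M k i * coord_hermite (enum_val i) z.
  rewrite /score /grad_tau mxE score_hermite//.
  by rewrite (sum_coord_action X k (fun c => coord_hermite c z)).
have E : (fun z => (score tau (tau_aff tau z) *m (score tau (tau_aff tau z))^T) a b) =
   (fun z => \sum_i \sum_j M a i * M b j * (coord_hermite (enum_val i) z * coord_hermite (enum_val j) z)).
  apply/funext => z; rewrite mxE big_ord1 [_^T _ _]mxE !sE mulr_suml.
  apply: eq_bigr => i _; rewrite mulr_sumr; apply: eq_bigr => j _; ring.
have gH (i j : 'I_N) := @gexp_coord_hermite R d (enum_val i) (enum_val j).
have gi (i : 'I_N) := @gexp_sum R d _ (index_enum 'I_N) predT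
  (fun j z => M a i * M b j * (coord_hermite (enum_val i) z * coord_hermite (enum_val j) z))
  (fun j => gintZ _ (gH i j).1).
have [g1 g2] := @gexp_sum R d _ (index_enum 'I_N) predT _ (fun i => (gi i).1).
rewrite -E in g1 g2.
have [_ ->//] := @q_expect_affine R d tau
  (fun x => (score tau x *m (score tau x)^T) a b) Ot (gint_meas g1).
rewrite g2 mxE; apply: eq_bigr => i _.
rewrite (gi i).2 [X in _ = _ * X]mxE.
rewrite (bigD1 i)//= big1 ?addr0; last first.
  move=> j ji; rewrite gexpZ; last exact: (gH i j).1.
  rewrite (gH i j).2 (inj_eq enum_val_inj) eq_sym (negPf ji) mul0r mulr0//.
rewrite gexpZ; last exact: (gH i i).1.
rewrite (gH i i).2 eqxx mul1r.
have -> : (M *m diag_mx fisher_weight) a i = M a i * (1 + coord_diag (enum_val i))%:R.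
  by rewrite mul_mx_diag [LHS]mxE; congr (_ * _); rewrite mxE.
by rewrite mulrAC.
Qed.

Lemma fisher_dual_normsqE tau (v : 'cV[R]_N) : Omega tau ->
  fisher_dual_normsq tau v =
  \sum_a (coord_action tau.2 *m v) a ord0 ^+ 2 / (1 + coord_diag (enum_val a))%:R.
Proof.
move=> Ot; have [Ct C0] := Ot; have U := Omega_unit Ot.
have [Xt _] : is_trig_mx (invmx tau.2) /\ forall i, invmx tau.2 i i = (tau.2 i i)^-1.
  by apply: invmx_trig => // i; rewrite gt_eqF.
set M := coord_action (invmx tau.2); set M' := coord_action tau.2.
have MM' : M *m M' = 1%:M by apply: coord_actionM => //; exact: mulmxV.
have M'M : M' *m M = 1%:M by exact: mulmx1C.
pose W : 'M[R]_N := diag_mx (map_mx GRing.inv fisher_weight).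
have NW : diag_mx fisher_weight *m W = 1%:M.
  rewrite /W; apply/matrixP => a b; rewrite mul_diag_mx !mxE.
  by case: eqP => _; rewrite ?mulr0n ?mulr0// !mulr1n divff//.
(* The explicit right inverse also shows that [fisher tau] is invertible, so that [invmx] in the
   dual norm is a genuine inverse. *)
have FI : fisher tau *m (M'^T *m W *m M') = 1%:M.
  rewrite fisherE// -/M !mulmxA -(mulmxA _ M^T) -trmx_mul M'M trmx1 mulmx1.
  by rewrite -(mulmxA M) NW mulmx1.
have [Fu _] := mulmx1_unit FI.
have -> : fisher_dual_normsq tau v = (v^T *m (M'^T *m W *m M') *m v) ord0 ord0.
  rewrite /fisher_dual_normsq; congr ((_ *m _ *m _) _ _).
  by apply: (can_inj (mulKmx Fu)); rewrite FI mulmxV.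
rewrite !mulmxA -trmx_mul -mulmxA -mulmxA mulmxA mxE; apply: eq_bigr => a _.
by rewrite /W mul_mx_diag !mxE; ring.
Qed.

End fisher_matrix.

(** * The Polyak-Lojasiewicz inequality *)

Section logarithm_bounds.
Context {R : realType}.
Implicit Types x y S A kappa : R.

(** With [y = expR t] this is [t <= sinh t] for [t >= 0]; the difference has derivative
    [cosh t - 1], which is nonnegative. *)
Lemma ln_le_half_sub_inv y : 1 <= y -> ln y <= (y - y^-1) / 2.
Proof.
move=> y1; have y0 : 0 < y by exact: lt_le_trans y1.
set t := ln y; have yE : y = expR t by rewrite lnK ?posrE.
have t0 : 0 <= t by exact: ln_ge0.
rewrite yE -expRN.
have [->|tn0] := eqVneq t 0; first by rewrite oppr0 subrr mul0r.
have tp : 0 < t by rewrite lt_neqAle eq_sym tn0.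
pose g (s : R) := (expR s - expR (- s)) / 2 - s.
pose g' (s : R) := (expR s + expR (- s)) / 2 - 1.
have dg (s : R) : is_derive s 1 g (g' s).
  by apply: is_derive_eq; rewrite /g' /GRing.scale /=; field.
have cg : continuous g.
  by move=> s; apply: differentiable_continuous; apply/derivable1_diffP; have [] := dg s.
have [c _] := @MVT R g g' 0 t tp (fun s _ => dg s) (continuous_subspaceT cg).
have g'c : 0 <= g' c.
  rewrite /g'; have a0 := expR_gt0 c; have b0 := expR_gt0 (- c).
  have ab : expR c * expR (- c) = 1 by rewrite -expRD subrr expR0.
  have := sqr_ge0 (expR c - 1); nra.
rewrite {1 2}/g oppr0 expR0 subrr mul0r !addr0 subr0 => E.
by rewrite -subr_ge0 E mulr_ge0.
Qed.

(** With [y = expR s] the difference of the two sides vanishes at [s = 0] and its derivative is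
    minus a square. *)
Lemma ln_le_quadratic y : 0 < y -> y <= 1 -> ln y <= (y - 1) - (y - 1) ^+ 2 / 2.
Proof.
move=> y0 y1.
set t := ln y; have yE : y = expR t by rewrite lnK ?posrE.
have t0 : t <= 0 by exact: ln_le0.
rewrite yE.
have [->|tn0] := eqVneq t 0; first by rewrite expR0 subrr expr0n/= mul0r subrr.
have tp : t < 0 by rewrite lt_neqAle tn0.
pose g (s : R) := (expR s - 1) - (expR s - 1) ^+ 2 / 2 - s.
pose g' (s : R) := - (expR s - 1) ^+ 2.
have dg (s : R) : is_derive s 1 g (g' s).
  by apply: is_derive_eq; rewrite /g' /GRing.scale /=; field.
have cg : continuous g.
  by move=> s; apply: differentiable_continuous; apply/derivable1_diffP; have [] := dg s.
have [c _] := @MVT R g g' t 0 tp (fun s _ => dg s) (continuous_subspaceT cg).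
have g'c : g' c <= 0 by rewrite oppr_le0 sqr_ge0.
rewrite {1}/g expR0 subrr expr0n/= mul0r !subr0 !sub0r => E.
rewrite -subr_ge0 -/(g t) -oppr_le0 E.
by rewrite mulr_le0_ge0// oppr_ge0 ltW.
Qed.

(* The quadratic in [S] is minimal at [- 2 * kappa * A]; this settles the claim
   unless [kappa * (1 + 2 * A) >= 1], where the minimum over [S >= kappa - 1] is
   attained at the end point and the worst [A] satisfies [kappa * (1 + A) ^+ 2 = 1]. *)
Lemma diagonal_gap_ge0 S A kappa : 0 < kappa -> kappa <= 1 -> kappa - 1 <= S -> - 1 < A ->
  0 <= S ^+ 2 / 2 + 2 * kappa * (S * A + kappa / 2 * A ^+ 2 + A - ln (1 + A)).
Proof.
move=> k0 k1 Sk A1; have y0 : 0 < 1 + A by lra.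
have [Ale0|Agt0] := leP A 0.
  have h := @ln_le_quadratic (1 + A) y0 ltac:(lra).
  (* A lower bound [kappa / 2 * A ^+ 2] for [A - ln (1 + A)] is exactly what completes the square
     [(S + 2 * kappa * A) ^+ 2 / 2]. *)
  have {}h : A ^+ 2 / 2 <= A - ln (1 + A) by lra.
  have h1 : kappa * (A ^+ 2 / 2) <= A - ln (1 + A).
    by apply: le_trans h; rewrite ler_piMl// divr_ge0 ?sqr_ge0.
  have h2 := ler_wpM2l (ltW k0) h1.
  have := sqr_ge0 (S + 2 * kappa * A); nra.
have [big|small] := leP 1 (kappa * (1 + 2 * A)).
  (* At the worst [A] one has [p = 1], so the tangent bound [ln p <= p - 1] is sharp where it
     matters. *)
  pose p := kappa * (1 + A) ^+ 2.
  have p0 : 0 < p by rewrite mulr_gt0// exprn_gt0.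
  have lp : ln p <= p - 1.
    by rewrite -ler_expR lnK ?posrE//; have := expR_ge1Dx (p - 1); lra.
  have lnp : ln p = ln kappa + 2 * ln (1 + A).
    by rewrite lnM ?posrE ?exprn_gt0// lnXn// mulr_natl.
  (* Once [S] is replaced by [kappa - 1] and [ln p] by its tangent, all terms in [A] cancel and [1 -
     kappa ^+ 2 + 2 * kappa * ln kappa >= 0] remains. *)
  have lk : (kappa - kappa^-1) / 2 <= ln kappa.
    have := @ln_le_half_sub_inv kappa^-1; rewrite invf_ge1// => /(_ k1).
    by rewrite lnV ?posrE// invrK; lra.
  have lk2 : kappa ^+ 2 - 1 <= 2 * kappa * ln kappa.
    have := ler_wpM2l (ltW k0) lk.
    rewrite mulrA mulrBr divff ?gt_eqF// -expr2; lra.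
  have h : 2 * kappa * ln (1 + A) <= kappa * (p - 1 - ln kappa).
    have := ler_wpM2l (ltW k0) lp; rewrite lnp; lra.
  (* The quadratic in [S] increases to the right of [kappa - 1]: the second factor is at least
     [2 * (kappa * (1 + 2 * A) - 1)]. *)
  have E : 0 <= (S - (kappa - 1)) * (S + (kappa - 1) + 4 * kappa * A).
    apply: mulr_ge0; first lra.
    nra.
  rewrite /p in h; nra.
(* Here [kappa * (1 + 2 * A) < 1] forces [kappa <= 1 / (1 + A)], and the bound needed to complete
   the square is again available. *)
have lA := @ln_le_half_sub_inv (1 + A) ltac:(lra).
have h : kappa / 2 * A ^+ 2 <= A - ln (1 + A).
  have e1 : (1 + A - (1 + A)^-1) / 2 = A - A ^+ 2 / (2 * (1 + A)).
    by field; rewrite gt_eqF.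
  have h1 : kappa <= (1 + A)^-1.
    by rewrite -[(1 + A)^-1]mul1r ler_pdivlMr//; nra.
  have h2 : kappa / 2 * A ^+ 2 <= A ^+ 2 / (2 * (1 + A)).
    rewrite (_ : A ^+ 2 / (2 * (1 + A)) = (1 + A)^-1 * (A ^+ 2 / 2)); last by field; rewrite gt_eqF.
    rewrite (_ : kappa / 2 * A ^+ 2 = kappa * (A ^+ 2 / 2)); last by field.
    by rewrite ler_wpM2r// divr_ge0// sqr_ge0.
  by move: lA; rewrite e1; lra.
have h2 := ler_wpM2l (ltW k0) h.
have := sqr_ge0 (S + 2 * kappa * A); nra.
Qed.

End logarithm_bounds.

Section coord_sum_by_row_and_column.
Context {d : nat}.

Lemma sum_coord (V : nmodType) (F : 'I_d -> option 'I_d -> V) :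
  \sum_(c : Defs.coord d) F (coord_row c) (coord_col c) =
  \sum_(k < d) F k None + \sum_(k < d) \sum_(j < d | (j <= k)%N) F k (Some j).
Proof.
rewrite big_sumType /=; congr (_ + _).
rewrite pair_big_dep /= (partition_big val (fun kj : 'I_d * 'I_d => (kj.2 <= kj.1)%N)) /=; last first.
  by move=> p _; exact: valP p.
apply: eq_bigr => kj Hkj.
rewrite (big_pred1 (exist _ kj Hkj)) //=.
Qed.

Lemma sum_coord_diag (V : nmodType) (g : 'I_d -> V) :
  \sum_(c : Defs.coord d | coord_diag c) g (coord_row c) = \sum_k g k.
Proof.
rewrite big_mkcond /=.
rewrite (sum_coord (fun k o => if o == Some k then g k else 0)) big1 ?add0r//.
apply: eq_bigr => k _; rewrite (bigD1 k)//= eqxx big1 ?addr0// => j /andP[_ jk].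
by rewrite (inj_eq Some_inj) (negPf jk).
Qed.

End coord_sum_by_row_and_column.

Section loewner.
Context {R : realType} {d : nat}.
Implicit Types (C : 'M[R]_d) (w : 'cV[R]_d).

Lemma sqnormD w1 w2 : sqnorm (w1 + w2) = sqnorm w1 + 2 * (w1^T *m w2) ord0 ord0 + sqnorm w2.
Proof.
rewrite !sqnormE mxE mulr_sumr -!big_split /=; apply: eq_bigr => i _.
by rewrite !mxE; ring.
Qed.

Lemma sqnormZ (a : R) w : sqnorm (a *: w) = a ^+ 2 * sqnorm w.
Proof. by rewrite !sqnormE mulr_sumr; apply: eq_bigr => i _; rewrite mxE exprMn. Qed.

(** The bound passes from [C C^T] to [C^T C] without spectral theory. With [u = C^-T w] the
    hypothesis gives [lam * sqnorm u <= sqnorm w], and expanding the square of [C w - lam u], whose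
    cross term is [sqnorm w], concludes. *)
Lemma loewner_gram_transpose C (lam : R) w : 0 <= lam -> C \in unitmx ->
  loewner_le lam%:M (C *m C^T) -> lam * sqnorm w <= sqnorm (C *m w).
Proof.
move=> lam0 U H; pose u := invmx C^T *m w.
have UT : C^T \in unitmx by rewrite unitmx_tr.
have Cu : C^T *m u = w by rewrite mulKVmx.
have hu : lam * sqnorm u <= sqnorm w.
  apply: le_trans (loewner_scalar_quad u H) _.
  by rewrite -Cu /sqnorm [X in _ <= (X *m _) _ _]trmx_mul trmxK !mulmxA.
have h0 := sqnorm_ge0 (C *m w + (- lam) *: u).
rewrite sqnormD sqnormZ -scalemxAr mxE in h0.
have E : ((C *m w)^T *m u) ord0 ord0 = sqnorm w.
  by rewrite trmx_mul -mulmxA Cu.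
rewrite E sqrrN in h0.
have := ler_wpM2l lam0 hu; lra.
Qed.

End loewner.

Section natural_gradient.
Context {R : realType} {d : nat} (l : 'cV[R]_d -> R) (delta : R).
Implicit Types (z : 'cV[R]_d) (tau : param R d) (c : Defs.coord d).
Hypothesis l2 : twice_differentiable l.
Hypothesis delta0 : 0 < delta.
Hypothesis lconv : forall x, loewner_le delta%:M (hessian l x).
Hypothesis KL_finite : forall tau, Omega tau -> integrable_Rn (KL_integrand tau (posterior l)).
Hypothesis Z0 : 0 < integral_Rn (fun y => expR (- l y)).
Local Notation N := #|Defs.coord d|.

Let deriveZ_l x v (a : R) : 'D_(a *: v) l x = a * 'D_v l x.
Proof. by have dl := l2.1 x; rewrite !deriveE// linearZ. Qed.

Definition natural_partial tau c z : R :=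
  monomial (coord_col c) z * 'D_(col (coord_row c) tau.2) l (tau_aff tau z).

(** Acting by [C] assembles partial derivatives of [l] into derivatives along columns of [C], and
    cancels the denominators [C_rr] of the logarithmic part, leaving 1 on the diagonal and 0
    elsewhere. *)
Lemma coord_action_grad_KL tau (a : 'I_N) : Omega tau ->
  gint (natural_partial tau (enum_val a)) /\
  (coord_action tau.2 *m grad_tau (KL (posterior l)) tau) a ord0 =
  gexp (natural_partial tau (enum_val a)) - (coord_diag (enum_val a))%:R.
Proof.
move=> Ot; have [Ct C0] := Ot; have /is_trig_mxP Clow := Ct.
set c := enum_val a.
pose P c' z := monomial (coord_col c') z * gradient l (tau_aff tau z) (coord_row c') ord0.
have gP c' := @grad_KL R d l delta l2 (ltW delta0) lconv KL_finite Z0 tau c' Ot.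
have gCP c' : gint (fun z => tau.2 (coord_row c') (coord_row c) * P c' z).
  exact: gintZ (gP c').1.
have [g1 g2] := @gexp_sum R d _ (index_enum (Defs.coord d)) (fun c' => coord_col c' == coord_col c) _ gCP.
have E : (fun z => \sum_(c' | coord_col c' == coord_col c) tau.2 (coord_row c') (coord_row c) * P c' z) =
    natural_partial tau c.
  apply/funext => z.
  pose g (k : 'I_d) := tau.2 k (coord_row c) * (monomial (coord_col c) z * gradient l (tau_aff tau z) k ord0).
  rewrite (eq_bigr (fun c' => g (coord_row c'))); last by move=> c' /eqP cc; rewrite /P cc.
  rewrite sum_same_col; last by move=> k kc; rewrite /g Clow// mul0r.
  rewrite /natural_partial derive_coord; last exact: l2.1.
  rewrite mulr_sumr; apply: eq_bigr => k _.
  by rewrite /g /gradient !mxE mulrCA.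
rewrite E in g1 g2; split=> //.
rewrite mxE.
pose G c' := 'D_(coord_dir R c') (KL (posterior l)) tau.
rewrite (eq_bigr (fun b => coord_action tau.2 a b * G (enum_val b))); last first.
  by move=> b _; rewrite /grad_tau [X in _ * X]mxE.
rewrite sum_coord_action -/c.
under eq_bigr do rewrite /G (gP _).2 mulrBr.
rewrite sumrB; congr (_ - _).
  rewrite g2; apply: eq_bigr => c' _; rewrite gexpZ//; exact: (gP c').1.
pose g (k : 'I_d) := tau.2 k (coord_row c) * ((coord_col c == Some k)%:R / tau.2 k k).
rewrite (eq_bigr (fun c' => g (coord_row c'))); last first.
  by move=> c' /eqP cc; rewrite /g /coord_diag cc.
rewrite sum_same_col; last by move=> k kc; rewrite /g Clow// mul0r.
rewrite (bigD1 (coord_row c))//= big1 ?addr0.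
  by rewrite /g /coord_diag; field; rewrite gt_eqF.
move=> k kc; rewrite /g; case: eqP => [ck|_]; last by rewrite mul0r mulr0.
rewrite Clow ?mul0r// ltn_neqAle (coord_col_le ck).
by move: kc; rewrite -val_eqE => ->.
Qed.

(* Averaging over the sign of the Gaussian coordinate [z_r] replaces Stein's identity,
   so that no integrability of the Hessian is required. *)
Lemma diag_partial_ge tau (a : 'I_N) : Omega tau -> coord_diag (enum_val a) ->
  delta * sqnorm (col (coord_row (enum_val a)) tau.2) <= gexp (natural_partial tau (enum_val a)).
Proof.
move=> Ot; set c := enum_val a => dc.
have [gi _] := coord_action_grad_KL a Ot; rewrite -/c in gi.
set w := col _ _; set r := coord_row c in w *.
have [fi fE] := gexp_flip r gi.
have cr : coord_col c = Some r by apply/eqP.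
have [m1 m2] := @gexp_monomial R d (coord_col c) (coord_col c).
rewrite eqxx in m2.
have h : gexp (fun z => 2 * (delta * sqnorm w) * (monomial (coord_col c) z * monomial (coord_col c) z)) <=
   gexp (fun z => natural_partial tau c z + natural_partial tau c (sign_flip r z)).
  apply: gexp_le; [exact: gintZ|exact: gintD|].
  move=> z; rewrite /natural_partial cr /= [sign_flip r z r ord0]mxE eqxx -/r -/w.
  set t := z r ord0.
  set x := tau_aff tau (sign_flip r z).
  have -> : tau_aff tau z = x + (2 * t) *: w.
    rewrite /x /tau_aff -addrA; congr (_ + _).
    have -> : w = tau.2 *m delta_mx r ord0 by rewrite -colE.
    rewrite scalemxAr -mulmxDr; congr (_ *m _); apply/colP => k.
    rewrite !mxE eqxx andbT; case: (eqVneq k r) => [->|_]; rewrite /t ?mulr1 ?mulr0; ring.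
  (* The two integrands are derivatives along [w] at [x + (2 * t) *: w] and at [x], with opposite
     signs; adding strong convexity in both directions between these points is strong monotonicity
     of the gradient. *)
  have s1 := strong_convexity l2 lconv x ((2 * t) *: w).
  have s2 := strong_convexity l2 lconv (x + (2 * t) *: w) (- (2 * t) *: w).
  rewrite -[x + _ + _]addrA -scalerDl subrr scale0r addr0 in s2.
  rewrite !sqnormZ !deriveZ_l sqrrN in s1 s2.
  move: s1 s2; move: (l x) (l (x + _)) ('D_w l x) ('D_w l (x + _)) (sqnorm w) => l1 l3 e f n s1 s2.
  clearbody t; clear -s1 s2; nra.
rewrite (gexpZ _ m1) (gexpD gi fi) fE m2 mulr1 in h.
by rewrite -(ler_pM2l (ltr0Sn R 1)) [leRHS]mulr_natl mulr2n.
Qed.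

(* Coordinates of [C^-1 (m' - m)] and [C^-1 (C' - C)], for [tau = (m, C)] and
   [tau' = (m', C')]. *)
Definition natural_coord tau tau' c : R :=
  if coord_col c is Some j then (invmx tau.2 *m (tau'.2 - tau.2)) (coord_row c) j
  else (invmx tau.2 *m (tau'.1 - tau.1)) (coord_row c) ord0.

(** The displacement [C^-1 (theta' - theta)] between the two samples built from the same [z],
    expanded over the coordinates. *)
Let disp tau tau' z : 'cV[R]_d :=
  \sum_c (natural_coord tau tau' c * monomial (coord_col c) z) *: delta_mx (coord_row c) ord0.

Let disp_trig tau tau' : Omega tau -> Omega tau' ->
  is_trig_mx (invmx tau.2 *m (tau'.2 - tau.2)).
Proof.
move=> [Ct C0] [Ct' _].
have [Xt _] : is_trig_mx (invmx tau.2) /\ forall i, invmx tau.2 i i = (tau.2 i i)^-1.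
  by apply: invmx_trig => // i; rewrite gt_eqF.
apply/is_trig_mxP => i j ij; rewrite mxE big1// => k _.
have [ik|ki] := ltnP i k; first by rewrite (is_trig_mxP Xt) ?mul0r.
by rewrite !mxE (is_trig_mxP Ct) ?(is_trig_mxP Ct') ?subrr ?mulr0//; exact: leq_ltn_trans ki ij.
Qed.

(** The diagonal of a product of triangular matrices is the product of the diagonals; this turns
    differences of [ln C_ii] into terms [ln (1 + A)]. *)
Lemma natural_coord_diag tau tau' c : Omega tau -> Omega tau' -> coord_diag c ->
  1 + natural_coord tau tau' c =
  tau'.2 (coord_row c) (coord_row c) / tau.2 (coord_row c) (coord_row c).
Proof.
move=> Ot Ot' /eqP dc; rewrite /natural_coord dc.
move: (coord_row c) => i.
have U := Omega_unit Ot; have [Ct C0] := Ot.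
have At := is_trig_mxP (disp_trig Ot Ot').
set A := _ *m _ in At *.
have CA : tau.2 *m A = tau'.2 - tau.2 by rewrite /A mulKVmx.
have := congr1 (fun M : 'M[R]_d => M i i) CA.
rewrite [X in X = _]mxE [X in _ = X]mxE [X in _ = _ + X]mxE (bigD1 i)//= big1 ?addr0.
  move=> E; apply: (mulfI (lt0r_neq0 (C0 i))); rewrite mulrDr E mulr1 mulrCA divff ?gt_eqF//; ring.
move=> k ki; have [ik|ki'] := ltnP i k; first by rewrite (is_trig_mxP Ct) ?mul0r.
by rewrite At ?mulr0// ltn_neqAle ki'; move: ki; rewrite -val_eqE => ->.
Qed.

Let dispE tau tau' z : Omega tau -> Omega tau' ->
  tau_aff tau' z = tau_aff tau z + tau.2 *m disp tau tau' z.
Proof.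
move=> Ot Ot'; have U := Omega_unit Ot.
have At := is_trig_mxP (disp_trig Ot Ot').
have -> : disp tau tau' z = invmx tau.2 *m (tau'.1 - tau.1) + (invmx tau.2 *m (tau'.2 - tau.2)) *m z.
  set A := _ *m (tau'.2 - _) in At *; set e := _ *m (tau'.1 - _).
  rewrite /disp.
  pose F (k : 'I_d) (o : option 'I_d) : 'cV[R]_d :=
    ((if o is Some j then A k j else e k ord0) * monomial o z) *: delta_mx k ord0.
  rewrite (eq_bigr (fun c => F (coord_row c) (coord_col c))); last first.
    by move=> c _; rewrite /F /natural_coord; case: (coord_col c).
  rewrite sum_coord; congr (_ + _).
    rewrite [RHS]matrix_sum_delta; apply: eq_bigr => k _.
    by rewrite big_ord1 /F /= mulr1.
  rewrite [RHS]matrix_sum_delta; apply: eq_bigr => k _.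
  rewrite big_ord1 /F mxE scaler_suml /= [RHS](bigID (fun j : 'I_d => (j <= k)%N)) /=.
  rewrite [X in _ = _ + X]big1 ?addr0// => j; rewrite -ltnNge => kj.
  by rewrite At// mul0r scale0r.
rewrite mulmxDr mulmxA !mulmxA mulmxV// !mul1mx /tau_aff mulmxBl.
by rewrite addrACA (addrC tau.1) subrK (addrC _ (_ - _)) subrK.
Qed.

(** Strong convexity is applied for each [z] from [m + C z] to [m' + C' z], and then averaged. The
    quadratic term is bounded below through [lam], after which orthonormality of the components of
    [(1, z)] makes it diagonal in the coordinates. *)
Lemma KL_gap_lower tau tau' (lam : R) : Omega tau -> Omega tau' ->
  (forall w, lam * sqnorm w <= sqnorm (tau.2 *m w)) ->
  \sum_c (natural_coord tau tau' c * gexp (natural_partial tau c) +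
    delta * lam / 2 * natural_coord tau tau' c ^+ 2 -
    (coord_diag c)%:R * ln (1 + natural_coord tau tau' c)) <=
  KL (posterior l) tau' - KL (posterior l) tau.
Proof.
move=> Ot Ot' Hlam.
rewrite (KL_posteriorE KL_finite Z0 Ot) (KL_posteriorE KL_finite Z0 Ot').
have gl := gint_posterior KL_finite Z0 Ot.
have gl' := gint_posterior KL_finite Z0 Ot'.
set al := natural_coord tau tau'.
have gn c : gint (natural_partial tau c).
  by have [] := coord_action_grad_KL (enum_rank c) Ot; rewrite enum_rankK.
have [s1 s2] := @gexp_sum R d _ (index_enum (Defs.coord d)) predT
  (fun c z => al c * natural_partial tau c z) (fun c => gintZ _ (gn c)).
have gm c c' := @gexp_monomial R d (coord_col c) (coord_col c').
have gM c := @gexp_sum R d _ (index_enum (Defs.coord d)) predT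
  (fun c' z => al c * al c' * (coord_row c == coord_row c')%:R *
     (monomial (coord_col c) z * monomial (coord_col c') z)) (fun c' => gintZ _ (gm c c').1).
have [M1 M2] := @gexp_sum R d _ (index_enum (Defs.coord d)) predT _ (fun c => (gM c).1).
have normE : gexp (fun z => sqnorm (disp tau tau' z)) = \sum_c al c ^+ 2 /\ gint (fun z => sqnorm (disp tau tau' z)).
  have -> : (fun z => sqnorm (disp tau tau' z)) = (fun z => \sum_c \sum_c' al c * al c' *
     (coord_row c == coord_row c')%:R * (monomial (coord_col c) z * monomial (coord_col c') z)).
    apply/funext => z; rewrite /sqnorm /disp.
    rewrite [X in (X *m _) _ _]raddf_sum mulmx_suml summxE; apply: eq_bigr => c _.
    rewrite mulmx_sumr summxE; apply: eq_bigr => c' _.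
    rewrite /= -scalemxAr [X in (_ *: (X *m _)) _ _]linearZ /= -scalemxAl mxE mxE trmx_delta mul_delta_mx_cond.
    rewrite mulrb; case: eqP => _; rewrite !mxE ?eqxx /=; rewrite -/al; ring.
  split; last exact: M1.
  rewrite M2; apply: eq_bigr => c _; rewrite (gM c).2 (bigD1 c)//= big1 ?addr0.
    by rewrite gexpZ; [rewrite (gm c c).2 !eqxx !mulr1 expr2|exact: (gm c c).1].
  move=> c' c'c; rewrite gexpZ; last exact: (gm c c').1.
  rewrite (gm c c').2 -mulrA -natrM mulnb.
  suff -> : (coord_row c == coord_row c') && (coord_col c == coord_col c') = false by rewrite mulr0.
  apply/negP => /andP[/eqP h1 /eqP h2]; move/eqP: c'c; apply.
  by apply/esym/coord_inj.
have [nE nI] := normE.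
have key : gexp (fun z => l (tau_aff tau z) + (\sum_c al c * natural_partial tau c z +
     delta / 2 * lam * sqnorm (disp tau tau' z))) <= gexp (fun z => l (tau_aff tau' z)).
  apply: gexp_le => //; first by apply: gintD => //; apply: gintD => //; exact: gintZ.
  move=> z; rewrite (dispE z Ot Ot').
  set D := disp _ _ z.
  apply: le_trans (strong_convexity l2 lconv _ _).
  rewrite -addrA lerD2l lerD//.
    have dl := l2.1 (tau_aff tau z).
    rewrite deriveE// /D /disp mulmx_sumr linear_sum /=.
    rewrite le_eqVlt; apply/orP; left; apply/eqP; apply: eq_bigr => c _.
    by rewrite -scalemxAr linearZ /= /natural_partial deriveE// -colE mulrA.
  rewrite -mulrA ler_wpM2l ?divr_ge0 ?(ltW delta0)//.
have gz : gint (fun z => delta / 2 * lam * sqnorm (disp tau tau' z)) by exact: gintZ.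
rewrite gexpD// in key; last exact: gintD.
rewrite gexpD// gexpZ// s2 nE in key.
have Eln : \sum_i ln (tau'.2 i i) - \sum_i ln (tau.2 i i) =
    \sum_c (coord_diag c)%:R * ln (1 + al c).
  have [_ C0] := Ot; have [_ C0'] := Ot'.
  rewrite -sumrB -(sum_coord_diag (fun i => ln (tau'.2 i i) - ln (tau.2 i i))).
  rewrite big_mkcond; apply: eq_bigr => c _.
  case: ifPn => [dc|_]; last by rewrite mul0r.
  by rewrite mul1r /al natural_coord_diag// ln_div ?posrE.
have E3 : \sum_c (al c * gexp (natural_partial tau c) +
    delta * lam / 2 * al c ^+ 2 - (coord_diag c)%:R * ln (1 + al c))
   = \sum_c al c * gexp (natural_partial tau c) + delta / 2 * lam * \sum_c al c ^+ 2 -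
     \sum_c (coord_diag c)%:R * ln (1 + al c).
  rewrite mulr_sumr -big_split /= -sumrB; apply: eq_bigr => c _.
  by congr (_ + _ - _); field.
rewrite E3 -Eln.
have -> : \sum_c al c * gexp (natural_partial tau c) =
    \sum_c gexp (fun z => al c * natural_partial tau c z).
  by apply: eq_bigr => c _; rewrite gexpZ.
lra.
Qed.

End natural_gradient.

Lemma delta_quad (R : comNzRingType) (n : nat) (X : 'M[R]_n) (i : 'I_n) :
  ((delta_mx ord0 i : 'rV_n) *m X *m (delta_mx i ord0 : 'cV_n)) ord0 ord0 = X i i.
Proof. by rewrite -rowE -colE !mxE. Qed.

(** * Bounded iterates force [delta * lambda_min <= 1] *)

Section iterates.
Context {R : realType} {d : nat} (l : 'cV[R]_d -> R) (delta : R).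
Hypothesis lconv : forall x, loewner_le delta%:M (hessian l x).

Lemma expected_hessian_quad tau (w : 'cV[R]_d) : Omega tau ->
  (forall i j, q_integrable tau (fun x => hessian l x i j)) ->
  delta * sqnorm w <= (w^T *m expected_hessian l tau *m w) ord0 ord0.
Proof.
move=> Ot Hfin.
pose h i j z := hessian l (tau_aff tau z) i j.
have hi i j := q_integrable_gint Ot (Hfin i j).
have gM i := @gexp_sum R d _ (index_enum 'I_d) predT
  (fun j z => w i ord0 * w j ord0 * h i j z) (fun j => gintZ _ (hi i j).1).
have [M1 M2] := @gexp_sum R d _ (index_enum 'I_d) predT _ (fun i => (gM i).1).
rewrite -[leLHS](gexp_cst (d := d) _).2.
have -> : (w^T *m expected_hessian l tau *m w) ord0 ord0 =
    gexp (fun z => \sum_i \sum_j w i ord0 * w j ord0 * h i j z).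
  rewrite M2 mxE; under [RHS]eq_bigr do rewrite (gM _).2.
  rewrite [RHS]exchange_big /=; apply: eq_bigr => j _.
  rewrite mxE mulr_suml; apply: eq_bigr => i _.
  by rewrite (gexpZ _ (hi i j).1) !mxE -(hi i j).2 mulrAC.
apply: gexp_le => //; first exact: (gexp_cst _).1.
by move=> z; exact: hessian_quad.
Qed.

(** The first row of a lower triangular matrix has a single entry [c]. Hence [c ^+ 2] is a diagonal
    entry of the covariance, at least [lam], and the update of [c] involves only [c] itself and one
    diagonal entry of [C^T H C - 1], which is at least [delta * lam - 1]. *)
Lemma svn_modulus_le1 (rho lam : R) (tau_ : nat -> param R d) (i0 : 'I_d) :
  0 < delta -> 0 < lam -> 0 < rho -> val i0 = 0%N ->
  (forall t, tau_ t.+1 = svn_step l rho (tau_ t)) ->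
  (forall t, Omega (tau_ t)) ->
  (forall t i j, q_integrable (tau_ t) (fun x => hessian l x i j)) ->
  (forall t, loewner_le lam%:M (cov (tau_ t))) ->
  delta * lam <= 1.
Proof.
move=> delta0 lam0 rho0 i00 step Om Hfin Vlow.
rewrite leNgt; apply/negP => kap1.
pose c t := (tau_ t).2 i0 i0.
have c0 t : 0 < c t by have [_] := Om t; apply.
have cE t : Num.sqrt lam <= c t.
  have [/is_trig_mxP Clow _] := Om t.
  have := loewner_scalar_quad (delta_mx i0 ord0) (Vlow t).
  rewrite /sqnorm trmx_delta mul_delta_mx mxE !eqxx mulr1.
  rewrite delta_quad /cov mxE (bigD1 i0)//= big1 ?addr0.
    rewrite mxE -expr2 -/(c t) => h.
    by rewrite -(ger0_norm (ltW (c0 t))) -sqrtr_sqr ler_wsqrtr.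
  move=> k ki; rewrite Clow ?mul0r// i00 lt0n.
  by move: ki; rewrite -val_eqE /= i00.
(* The relative decrease of [c] per step; the factor 1/2 is the halved diagonal in [tril]. *)
pose eta := rho / 2 * (delta * lam - 1).
have eta0 : 0 < eta by rewrite mulr_gt0 ?divr_gt0// subr_gt0.
have cS t : c t.+1 <= c t - eta * Num.sqrt lam.
  have Ot := Om t; have [/is_trig_mxP Clow C0] := Ot.
  pose W := (tau_ t).2^T *m expected_hessian l (tau_ t) *m (tau_ t).2 - 1%:M.
  have -> : c t.+1 = c t - rho * (c t * (W i0 i0 / 2)).
    rewrite /c step /svn_step /= mxE [X in _ + X]mxE [X in _ - X]mxE -/W.
    congr (_ - _ * _); rewrite mxE (bigD1 i0)//= big1 ?addr0.
      by rewrite [tril _ _ _]mxE ltnn eqxx.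
    move=> k ki; rewrite Clow ?mul0r// i00 lt0n.
    by move: ki; rewrite -val_eqE /= i00.
  have h : delta * lam - 1 <= W i0 i0.
    rewrite /W [X in _ <= X]mxE [X in _ <= _ + X]mxE [X in _ <= _ - X]mxE eqxx lerB//.
    have := expected_hessian_quad (col i0 (tau_ t).2) Ot (Hfin t).
    have -> : ((col i0 (tau_ t).2)^T *m expected_hessian l (tau_ t) *m col i0 (tau_ t).2) ord0 ord0
      = ((tau_ t).2^T *m expected_hessian l (tau_ t) *m (tau_ t).2) i0 i0.
      by rewrite colE trmx_mul trmx_delta -(delta_quad (_ *m _) i0) !mulmxA.
    apply: le_trans; rewrite ler_wpM2l ?(ltW delta0)//.
    have := @loewner_gram_transpose R d _ lam (delta_mx i0 ord0) (ltW lam0) (Omega_unit Ot) (Vlow t).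
    rewrite -colE; apply: le_trans.
    by rewrite /sqnorm trmx_delta mul_delta_mx mxE !eqxx mulr1.
  rewrite lerD2l lerN2 /eta.
  apply: (@le_trans _ _ (rho / 2 * (delta * lam - 1) * c t)).
    by rewrite ler_wpM2l// ltW.
  rewrite (_ : rho * (c t * (W i0 i0 / 2)) = rho / 2 * W i0 i0 * c t); last by field.
  by rewrite ler_wpM2r ?(ltW (c0 t))// ler_wpM2l// divr_ge0// ltW.
have s0 : 0 < eta * Num.sqrt lam by rewrite mulr_gt0// sqrtr_gt0.
have ct t : c t <= c 0%N - eta * Num.sqrt lam * t%:R.
  elim: t => [|t IH]; first by rewrite mulr0 subr0.
  apply: le_trans (cS t) _; rewrite -natr1 mulrDr mulr1 opprD addrA lerD2r//.
have := archi_boundP (divr_ge0 (ltW (c0 0%N)) (ltW s0)).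
rewrite ltr_pdivrMr// mulrC => h.
have := ct (Num.bound (c 0%N / (eta * Num.sqrt lam))).
by apply/negP; rewrite -ltNge; apply: lt_trans (c0 _); rewrite subr_lt0.
Qed.

End iterates.

Section polyak_lojasiewicz.
Context {R : realType} {d : nat} (l : 'cV[R]_d -> R) (delta : R).
Hypothesis l2 : twice_differentiable l.
Hypothesis delta0 : 0 < delta.
Hypothesis lconv : forall x, loewner_le delta%:M (hessian l x).
Hypothesis KL_finite : forall tau, Omega tau -> integrable_Rn (KL_integrand tau (posterior l)).

Lemma KL_PL_inequality (lam : R) (tau tau' : param R d) :
  0 < integral_Rn (fun y => expR (- l y)) ->
  0 < lam -> delta * lam <= 1 -> Omega tau -> Omega tau' ->
  loewner_le lam%:M (cov tau) ->
  2 * (delta * lam) * (KL (posterior l) tau - KL (posterior l) tau') <=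
  fisher_dual_normsq tau (grad_tau (KL (posterior l)) tau).
Proof.
move=> Z0 lam0 k1 Ot Ot' Vlow.
have U := Omega_unit Ot.
have Hlam w : lam * sqnorm w <= sqnorm (tau.2 *m w).
  exact: loewner_gram_transpose (ltW lam0) U Vlow.
have gap := KL_gap_lower l2 delta0 lconv KL_finite Z0 Ot Ot' Hlam.
rewrite fisher_dual_normsqE//.
set kap := delta * lam in k1 gap *.
have k0 : 0 < kap by rewrite mulr_gt0.
rewrite -subr_ge0 -mulrN opprB.
pose G c := natural_coord tau tau' c * gexp (natural_partial l tau c) +
    kap / 2 * natural_coord tau tau' c ^+ 2 - (coord_diag c)%:R * ln (1 + natural_coord tau tau' c).
apply: (@le_trans _ _ (\sum_a (coord_action tau.2 *m grad_tau (KL (posterior l)) tau) a ord0 ^+ 2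
    / (1 + coord_diag (enum_val a))%:R + 2 * kap * \sum_(a < #|Defs.coord d|) G (enum_val a))); last first.
  by rewrite lerD2l; apply: ler_wpM2l; [apply: mulr_ge0 => //; exact: ltW|rewrite (sum_enum_val G)].
rewrite mulr_sumr -big_split /=; apply: sumr_ge0 => a _; rewrite /G.
have [_ ->] := coord_action_grad_KL l2 delta0 lconv KL_finite Z0 a Ot.
have dge := diag_partial_ge l2 delta0 lconv KL_finite Z0 (a := a) Ot.
have al1 : coord_diag (enum_val a) -> -1 < natural_coord tau tau' (enum_val a).
  move=> dc; rewrite -subr_gt0 opprK addrC (natural_coord_diag Ot Ot' dc).
  by rewrite divr_gt0//; [case: Ot'|case: Ot].
move: dge al1; set T := gexp _; set A := natural_coord _ _ _.
case: (coord_diag _) => /= [dge al1|_ _].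
  (* A column of [C] is the image of a unit vector, so its squared norm is at least [lam]; this
     supplies the constraint [S >= kappa - 1]. *)
  have Tk : kap <= T.
    apply: le_trans (dge isT); rewrite /kap ler_wpM2l ?(ltW delta0)// colE.
    apply: le_trans (Hlam _).
    by rewrite /sqnorm trmx_delta mul_delta_mx mxE !eqxx mulr1.
  have := @diagonal_gap_ge0 R (T - 1) A kap k0 k1.
  rewrite lerB// => /(_ isT (al1 isT)).
  by congr (0 <= _); rewrite mul1r; field.
rewrite subr0 divr1 mul0r subr0.
have -> : T ^+ 2 + 2 * kap * (A * T + kap / 2 * A ^+ 2) = (T + kap * A) ^+ 2 by field.
exact: sqr_ge0.
Qed.

End polyak_lojasiewicz.

Theorem lemma2 (R : realType) (d : nat) (l : 'cV[R]_d -> R) (delta rho : R)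
    (tau_star : param R d) (tau_ : nat -> param R d)
    (xi_l xi_u lambda_min : R)
    (l_twice_diff : twice_differentiable l)
    (delta_gt0 : 0 < delta)
    (l_strongly_convex : forall x, loewner_le delta%:M (hessian l x))
    (KL_finite : forall tau, Omega tau ->
      integrable_Rn (KL_integrand tau (posterior l)))
    (tau_star_min : is_KL_minimizer (posterior l) tau_star)
    (rho_gt0 : 0 < rho)
    (iterates : svn_iterates l rho tau_)
    (iterates_Omega : forall t, Omega (tau_ t))
    (g_finite : forall t i,
      q_integrable (tau_ t) (fun x => gradient l x i ord0))
    (H_finite : forall t i j,
      q_integrable (tau_ t) (fun x => hessian l x i j))
    (xi_bounds : 0 < xi_l <= xi_u)
    (lambda_min_gt0 : 0 < lambda_min)
    (C_bounded : forall t, xi_l <= frobenius_norm (tau_ t).2 <= xi_u)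
    (V_lower : forall t, loewner_le lambda_min%:M (cov (tau_ t))) :
  let lambda_g := Num.min lambda_min (lambda_min ^+ 2 / 2) in
  let mu := delta * lambda_g in
  forall tau : param R d, Omega tau -> loewner_le lambda_min%:M (cov tau) ->
    2 * mu * (KL (posterior l) tau - KL (posterior l) tau_star) <=
    fisher_dual_normsq tau (grad_tau (KL (posterior l)) tau).
Proof.
move=> lambda_g mu tau Ot Vlow; have [Os min_s] := tau_star_min.
(* The inequality is proved with [delta * lambda_min]; nonnegativity of the gap, from minimality of
   [tau_star], permits the smaller constant [mu]. *)
have mu_le : mu <= delta * lambda_min by rewrite ler_wpM2l ?(ltW delta_gt0)// ge_min lexx.
have gap0 : 0 <= KL (posterior l) tau - KL (posterior l) tau_star by rewrite subr_ge0 min_s.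
have norm0 v : 0 <= fisher_dual_normsq tau v.
  by rewrite fisher_dual_normsqE//; apply: sumr_ge0 => a _; rewrite divr_ge0// sqr_ge0.
(* In dimension 0 there is no first diagonal entry to follow, but the parameter space is a single
   point and the gap is 0. *)
have [[i0 i00]|noi] := pselect (exists i : 'I_d, val i = 0%N); last first.
  have noI (i : 'I_d) : False.
    by apply: noi; exists (Ordinal (leq_ltn_trans (leq0n i) (ltn_ord i))).
  have E : tau = tau_star.
    rewrite [LHS]surjective_pairing [RHS]surjective_pairing.
    by congr pair; apply/matrixP => i; case: (noI i).
  by rewrite [X in KL _ X - _]E subrr mulr0.
have modulus_le1 : delta * lambda_min <= 1.
  exact: (svn_modulus_le1 l_strongly_convex delta_gt0 lambda_min_gt0 rho_gt0 i00 iterates.2).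
have : 0 <= integral_Rn (fun y => expR (- l y)).
  by apply: Rintegral_ge0 => t _; exact: expR_ge0.
rewrite le_eqVlt => /orP[/eqP Z0|Z0]; last first.
  apply: le_trans (KL_PL_inequality l_twice_diff delta_gt0 l_strongly_convex KL_finite
    Z0 lambda_min_gt0 modulus_le1 Ot Os Vlow).
  by rewrite ler_wpM2r// ler_wpM2l.
(* With normalising integral 0, the conventions [0^-1 = 0] and [ln 0 = 0] make the posterior and
   then the integrand of the divergence vanish identically. *)
have KL0 tau' : KL (posterior l) tau' = 0.
  rewrite /KL /KL_integrand /posterior -Z0 /integral_Rn.
  under eq_Rintegral do rewrite invr0 !mulr0 invr0 mulr0 ln0// mulr0.
  by rewrite /Rintegral integral0.
by rewrite !KL0 subrr mulr0.
Qed.
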